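(* Consider the discrete-time infinite single-hop network on $\mathbb{Z}^d$ described in the context, with service algorithm (D1) or (D2). Let $\bar\lambda=(\lambda_i)_{i\in\mathbb{Z}^d}$ be periodic, and let $\xi_i$, with $\mathbb{E}\xi_i=\lambda_i$, be i.i.d. up to periodicity with $\mathbb{E}\xi_i^3<\infty$ for all $i$. Assume that there exists a periodic $\bar\nu$ from the set $$\mathcal{C}=\{\bar\mu:\ \text{there exists } \bar p\in\mathbb{R}_+^{\mathbb{Z}^d}\ \text{such that}\ \bar\mu\le\bar\psi(\bar p)\}$$ such that $\bar\lambda<\bar\nu$. Consider an infinite network with arrival rates $\bar\lambda'\le\bar\lambda$ and assume in addition that the per-slot (random) number of arrivals $\xi_i'$ is dominated by $\xi_i$ w.p.1, i.e. $\xi_i'\le\xi_i$. Then this infinite network is stable, and there exists a stationary regime with finite second moments $\mathbb{E}X_i^2<\infty$ of the queue lengths, for all $i$.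
   Context: Rates. Let $(a_i)_{i\in\mathbb{Z}^d}$ satisfy $a_0=1$, $a_i=a_{-i}\ge0$ and $L=\sup\{|i|:a_i>0\}<\infty$. Set $\mathcal{N}_i=\{j:a_{j-i}>0\}$ (the neighbours of $i$, including $i$) and $$\psi_i(\bar x)=\frac{x_i}{\sum_{j\in\mathbb{Z}^d}a_{j-i}x_j},\qquad \bar x\in\mathbb{R}_+^{\mathbb{Z}^d},\quad 0/0:=0.$$ Vector inequalities are component-wise. Dynamics. The state is $\bar X(k)\in\mathbb{Z}_+^{\mathbb{Z}^d}$, with $X_i(k+1)=X_i(k)+\xi_i(k)-\eta_i(k)$, where $\xi_i(k)$ is the number of arrivals to node $i$ in slot $k$ and $\eta_i(k)\in\{0,1\}$ indicates that node $i$ transmits (serves one job, which leaves the network) in slot $k$. The $\xi_i(k)$ are independent over $i$ and $k$ and, for each $i$, i.i.d. over $k$ with generic copy $\xi_i$; the arrival rate is $\lambda_i=\mathbb{E}\xi_i$. (For the network with arrivals $\xi'_i$, replace $\xi_i(k)$ by $\xi'_i(k)$, with $\lambda_i'=\mathbb{E}\xi_i'$.) The services are driven by random variables $U_i(k)$, i.i.d. over $i,k$, uniform on $[0,1]$, independent of the arrivals, by one of two algorithms: (D1) let $\tau_i(k)=[-\log U_i(k)]/X_i(k)$ ($=\infty$ if $X_i(k)=0$); node $i$ transmits in slot $k$ iff $X_i(k)>0$ and $\tau_i(k)<\tau_j(k)/a_{j-i}$ for all $j\in\mathcal{N}_i\setminus\{i\}$; (D2) node $i$ transmits in slot $k$ iff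 $X_i(k)>0$ and $U_i(k)<\psi_i(\bar X(k))$. In both cases the conditional probability that $i$ transmits given $\bar X(k)$ is $\psi_i(\bar X(k))$. Periodicity. A function $i\mapsto\lambda_i$ on $\mathbb{Z}^d$ is periodic if $\lambda_{i+C_ke_k}=\lambda_i$ for all $i\in\mathbb{Z}^d$, $k=1,\dots,d$, where $C_1,\dots,C_d$ are fixed positive integers (the same for all periodic objects) and $e_k$ is the $k$-th unit vector. Random variables $\xi_i$ are i.i.d. up to periodicity if they are all independent and $\xi_{i+C_ke_k}$ and $\xi_i$ have identical distribution for all $i,k$. Stability of the infinite network means existence of a proper stationary distribution of $\bar X(\cdot)$ (all queues finite with probability 1). *)

(* Defs.v *)
From HB Require Import structures.
From mathcomp Require Import all_boot all_order all_algebra finmap.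
From mathcomp Require Import all_classical all_reals all_analysis.
Set Implicit Arguments.
Unset Strict Implicit.
Unset Printing Implicit Defensive.
Import Order.TTheory GRing.Theory Num.Theory.
Import numFieldNormedType.Exports.
Local Open Scope classical_set_scope.
Local Open Scope ring_scope.

(* Z^d is 'rV[int]_d.  The range condition is stated for the max-norm; as all
   norms on Z^d are equivalent, finiteness of L does not depend on this. *)
Definition interaction (R : realType) (d : nat) (a : 'rV[int]_d -> R) : Prop :=
  [/\ a 0 = 1, forall i, a i = a (- i), forall i, 0 <= a i &
      exists L : nat, forall i, 0 < a i -> (\max_(k < d) `|i 0%R k| <= L)%N].

(* The finite-range condition makes this sum finitely supported, as \sum over a
   classical set requires; division by 0 gives 0, in accordance with 0/0 = 0. *)
Definition psi (R : realType) (d : nat) (a x : 'rV[int]_d -> R)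
    (i : 'rV[int]_d) : R :=
  x i / (\sum_(j \in [set: 'rV[int]_d]) a (j - i) * x j).

Definition rate_region (R : realType) (d : nat) (a : 'rV[int]_d -> R) :
    set ('rV[int]_d -> R) :=
  [set mu | exists p : 'rV[int]_d -> R,
      (forall i, 0 <= p i) /\ (forall i, mu i <= psi a p i)].

Definition lattice_periodic (T : Type) (d : nat) (C : 'I_d -> nat)
    (f : 'rV[int]_d -> T) : Prop :=
  forall (i : 'rV[int]_d) (k : 'I_d), f (i + delta_mx 0 k *+ C k) = f i.

Definition cylinders (d : nat) : set (set ('rV[int]_d -> nat)) :=
  \bigcup_(i in [set: 'rV[int]_d])
    preimage_set_system setT (fun x : 'rV[int]_d -> nat => x i) measurable.

(* Configurations with all queues finite, with the product sigma-algebra: a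
   probability on this type is a proper distribution of queue lengths. *)
Definition state (d : nat) := g_sigma_algebraType (@cylinders d).

(* D1: race of exponential clocks among the neighbours; D2: each node transmits
   with conditional probability psi, independently of the other nodes. *)
Variant algorithm := D1 | D2.

Section Dynamics.
Context (R : realType) (d : nat) (alg : algorithm) (a : 'rV[int]_d -> R).

(* -log u / x_i; lne 0 = -oo makes this +oo at u = 0. *)
Definition tau (x : state d) (u : 'rV[int]_d -> R) (i : 'rV[int]_d) : \bar R :=
  if x i == 0%N then +oo%E else (- lne (u i)%:E * ((x i)%:R^-1)%:E)%E.

Definition transmits (x : state d) (u : 'rV[int]_d -> R) (i : 'rV[int]_d) :
    bool :=
  (0 < x i)%N &&
  match alg with
  | D1 => `[< forall j, 0 < a (j - i) -> j != i ->
              (tau x u i < tau x u j * ((a (j - i))^-1)%:E)%E >]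
  | D2 => u i < psi a (fun j => (x j)%:R) i
  end.

(* The subtraction in nat is exact: a node transmits only if its queue is
   nonempty. *)
Definition step (x : state d) (n : 'rV[int]_d -> nat) (u : 'rV[int]_d -> R) :
    state d :=
  fun i => (x i + n i - transmits x u i)%N.

Fixpoint queues (Omega : Type) (xi : nat -> 'rV[int]_d -> Omega -> nat)
    (U : nat -> 'rV[int]_d -> Omega -> R) (k : nat) (z : state d * Omega) :
    state d :=
  match k with
  | 0 => z.1
  | k'.+1 => step (queues xi U k' z) (xi k' ^~ z.2) (U k' ^~ z.2)
  end.

End Dynamics.

Definition mutually_independent (R : realType) (dd : measure_display)
    (Omega : measurableType dd) (P : probability Omega R) (I : choiceType)
    (F : I -> set (set Omega)) : Prop :=
  forall (J : {fset I}) (E : I -> set Omega),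
    (forall j, j \in J -> F j (E j)) ->
    P (\bigcap_(j in [set` J]) E j) = (\prod_(j <- J) P (E j))%E.

Section Driving.
Context (R : realType) (d : nat) (dd : measure_display).
Context (Omega : measurableType dd) (P : probability Omega R).
Implicit Types (xi : nat -> 'rV[int]_d -> {RV P >-> nat})
  (U : nat -> 'rV[int]_d -> {RV P >-> R}) (lambda : 'rV[int]_d -> R).

Definition driving_sigma xi U
    (s : (nat * 'rV[int]_d) + (nat * 'rV[int]_d)) : set (set Omega) :=
  match s with
  | inl (k, i) => g_sigma_algebra_preimage (xi k i)
  | inr (k, i) => g_sigma_algebra_preimage (U k i)
  end.

Definition driving xi U lambda : Prop :=
  [/\ mutually_independent P (driving_sigma xi U),
      forall k i, distribution P (xi k i) = distribution P (xi 0%N i),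
      forall k i, ('E_P[fun w => ((xi k i w)%:R)%R] = (lambda i)%:E)%E &
      forall k i A, measurable A ->
        distribution P (U k i) A = uniform_prob (@ltr01 R) A].

(* On the product space pi \x P the initial state z.1 has law pi and is
   independent of all the driving variables. *)
Definition stationary_distribution (alg : algorithm) (a : 'rV[int]_d -> R)
    xi U (pi : probability (state d) R) : Prop :=
  forall (k : nat) (A : set (state d)), measurable A ->
    (pi \x P)%E [set z | A (queues alg a xi U k z)] = pi A.

Definition stable (alg : algorithm) (a : 'rV[int]_d -> R) xi U : Prop :=
  exists pi : probability (state d) R, stationary_distribution alg a xi U pi.

(* Strict stationarity: shift-invariance of all finite-dimensional laws of the
   process started from pi. *)
Definition stationary_regime (alg : algorithm) (a : 'rV[int]_d -> R)
    xi U (pi : probability (state d) R) : Prop :=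
  forall (k n : nat) (A : nat -> set (state d)),
    (forall m, measurable (A m)) ->
    (pi \x P)%E [set z | forall m, (m <= n)%N -> A m (queues alg a xi U (k + m) z)]
    = (pi \x P)%E [set z | forall m, (m <= n)%N -> A m (queues alg a xi U m z)].

End Driving.

(* Main.v *)
(* The dynamics is monotone in the queues and in the arrivals, so the Loynes
   construction applies: start from empty queues further and further in the past,
   using the driving variables of one sample point in reversed time order, and let
   the queues at time 0 increase to a limit.  If the limit is finite it satisfies
   the one-step recursion, and its law is stationary because the doubly infinite
   noise sequence is shift invariant in law.

   Finiteness and second moments come from the Lyapunov function
   V(x) = sum_i phi_i x_i^3 / nu_i^2.  Writing S_i = sum_j a_(j-i) x_j, so that
   psi_i(x) = x_i / S_i, AM-GM gives
     x_i^2 (nu_i - psi_i(x)) / nu_i^2 <= x_i S_i - x_i^2 / nu_i.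
   If nu <= psi(p), the symmetry of a and x_i x_j <= (x_i^2 p_j / p_i +
   x_j^2 p_i / p_j) / 2 show that sum_i x_i S_i <= sum_i x_i^2 / nu_i, and the
   weights phi_i = q^|i|, with q < 1 close to 1, only cost a factor close to 1.
   Hence the drift of V is at most - c sum_i phi_i x_i^2 + const; as the mean of V
   cannot decrease along the Loynes scheme, sum_i phi_i E x_i^2 stays bounded.
   Under D1 a given node wins its exponential
   race with probability E U^c = 1 / (1 + c) = psi_i(x). *)
Require Import Defs.
From HB Require Import structures.
From mathcomp Require Import all_boot all_order all_algebra finmap.
From mathcomp Require Import all_classical all_reals all_analysis.
From mathcomp Require Import measurable_realfun.
From mathcomp Require Import ring lra zify.
Set Implicit Arguments.
Unset Strict Implicit.
Unset Printing Implicit Defensive.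
Import Order.TTheory GRing.Theory Num.Theory.
Import numFieldNormedType.Exports.
Local Open Scope classical_set_scope.
Local Open Scope ring_scope.

(** * Laws of independent families *)

(** The driving variables live on an arbitrary probability space and carry only nonnegative times,
    so no two-sided noise is given. It is made from [P \x P]: for an independent family the joint
    law is determined by the marginals, so relabelling the variables of two copies along an
    injection that preserves marginals preserves the law. Three facts are instances of this:
    stationarity, the independence of a queue from the next slot, and the redrawing of one clock in
    the race.

    The cube is the power whose drift is of order x^2, the moment wanted, and its expansion calls
    for exactly three moments of the arrivals. The weight nu^-2 is chosen so that the nonlinear term
    x^2 psi(x) is controlled by a quadratic form in x; [p] enters only as the test vector of a Schur
    test for that form.

    Cancelling the mean of V from both sides of the drift inequality requires it to be finite,
    whence the truncated arrivals. The truncation level and the number of past slots grow together,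
    and the moment bounds are uniform in both. Periodicity provides a uniform gap between [lambda]
    and [nu] and a uniform third moment. *)

Section CylinderSigmaAlgebra.
Context (I : Type) (dv : measure_display) (V : measurableType dv).

(** With the lattice for [I] and [nat] for [V] this unfolds to [cylinders d], so [config] covers the
    state space as well as the space of noise configurations. *)
Definition coordinate_cylinders : set (set (I -> V)) :=
  \bigcup_(i in [set: I])
    preimage_set_system setT (fun x : I -> V => x i) measurable.

Definition config := g_sigma_algebraType coordinate_cylinders.

Lemma measurable_coordinate (i : I) :
  measurable_fun setT (fun x : config => x i).
Proof.
move=> _ A mA; apply: sub_sigma_algebra; exists i => //.
by exists A.
Qed.

Lemma measurable_to_config (dt : measure_display) (T : measurableType dt)
    (f : T -> config) :
  (forall i, measurable_fun setT (fun t => f t i)) -> measurable_fun setT f.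
Proof.
move=> mf; apply: (@measurability _ _ T config setT f coordinate_cylinders) => //.
by move=> _ [_ [i _ [A mA <-]] <-]; rewrite !setTI; rewrite -[X in measurable X]setTI; exact: mf.
Qed.

End CylinderSigmaAlgebra.
Arguments config I {dv} V.

Section ConfigLaw.
Context (R : realType) (I : choiceType) (dv : measure_display)
  (V : measurableType dv).

Definition finite_cylinder (J : {fset I}) (E : I -> set V) : set (config I V) :=
  [set x | forall j, j \in J -> E j (x j)].

Lemma measurable_finite_cylinder (J : {fset I}) (E : I -> set V) :
  (forall j, measurable (E j)) -> measurable (finite_cylinder J E).
Proof.
move=> mE; rewrite (_ : finite_cylinder J E =
    \bigcap_(j in [set` J]) ((fun x : config I V => x j) @^-1` E j)); last first.
  by apply/seteqP; split => x h j /= /h.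
apply: fin_bigcap_measurable; first exact: finite_fset.
by move=> j _; rewrite -[X in measurable X]setTI; exact: measurable_coordinate.
Qed.

(** Finite cylinders are stable under intersection and generate the sigma-algebra, so the uniqueness
    theorem for measures applies. *)
Lemma config_measure_eq (m1 m2 : probability (config I V) R) :
  (forall (J : {fset I}) (E : I -> set V), (forall j, measurable (E j)) ->
    m1 (finite_cylinder J E) = m2 (finite_cylinder J E)) ->
  forall A, measurable A -> m1 A = m2 A.
Proof.
move=> m12 A mA.
pose G : set (set (config I V)) :=
  [set B | exists (J : {fset I}) (E : I -> set V),
    (forall j, measurable (E j)) /\ B = finite_cylinder J E].
have GT : G setT.
  exists fset0, (fun=> setT); split => //.
  by apply/seteqP; split => // x _ j; rewrite inE.
apply: (@measure_unique _ R _ G (fun=> setT)) => //.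
- apply/seteqP; split; last first.
    apply: smallest_sub; first exact: sigma_algebra_measurable.
    by move=> _ [J [E [mE ->]]]; exact: measurable_finite_cylinder.
  apply: smallest_sub; first exact: smallest_sigma_algebra.
  move=> _ [i _ [B mB <-]]; apply: sub_sigma_algebra.
  exists [fset i]%fset, (fun=> B); split => //.
  rewrite setTI; apply/seteqP; split => x /=.
    by move=> Bx j /=; rewrite inE => /eqP ->.
  by apply; rewrite inE.
- move=> _ _ [J1 [E1 [mE1 ->]]] [J2 [E2 [mE2 ->]]].
  exists (J1 `|` J2)%fset, (fun j => (if j \in J1 then E1 j else setT) `&`
     (if j \in J2 then E2 j else setT)); split.
    by move=> j; apply: measurableI; case: ifP.
  apply/seteqP; split => x /=.
    move=> [h1 h2] j; rewrite in_fsetU => _; split; case: ifP => //.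
      by move/h1.
    by move/h2.
  move=> h; split => j jJ.
    by have := h j; rewrite in_fsetU jJ => /(_ isT)[].
  by have := h j; rewrite in_fsetU jJ orbT => /(_ isT)[].
- by apply/seteqP; split => // x _; exists 0%N.
- by move=> _ [J [E [mE ->]]]; exact: m12.
- by move=> _; rewrite (le_lt_trans (probability_le1 _ _)) ?ltry.
Qed.

End ConfigLaw.

(** * Reindexing two independent copies of a family *)

Section IndependentCopies.
Context (R : realType) (dd : measure_display) (Omega : measurableType dd)
  (P : probability Omega R) (I : choiceType) (dv : measure_display)
  (V : measurableType dv).
Context (X : I -> Omega -> V) (F : I -> set (set Omega)).
Hypothesis mX : forall s, measurable_fun setT (X s).
Hypothesis FX : forall s B, measurable B -> F s (X s @^-1` B).
Hypothesis indF : mutually_independent P F.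

(** The Boolean selects the sample point at which a variable is read. This doubles the index set of
    an independent family without constructing an infinite product space. *)
Definition two_copies (z : Omega * Omega) : config (bool * I)%type V :=
  fun bs => X bs.2 (if bs.1 then z.2 else z.1).

Lemma measurable_reindexed_copies (s : bool * I -> bool * I) :
  measurable_fun setT
    (fun z => (fun j => two_copies z (s j)) : config (bool * I)%type V).
Proof.
apply: measurable_to_config => j; rewrite /two_copies.
case: (s j) => -[] i /=.
  by apply: measurableT_comp => //; exact: measurable_snd.
by apply: measurableT_comp => //; exact: measurable_fst.
Qed.

Lemma independent_reindexed (K : choiceType) (J : {fset K}) (f : K -> I)
    (E : K -> set V) :
  {in J &, injective f} -> (forall j, measurable (E j)) ->
  P [set w | forall j, j \in J -> E j (X (f j) w)] =
  (\prod_(j <- J) P (X (f j) @^-1` E j))%E.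
Proof.
move=> injf mE.
(* [f] has no inverse at hand, so the constraint at [s] is the intersection over its fibre in [J]: a
   single [E j] on the image of [J], the full set elsewhere. *)
pose B (s : I) : set V := \bigcap_(j in [set j | j \in J /\ f j = s]) E j.
have BE j : j \in J -> B (f j) = E j.
  move=> jJ; apply/seteqP; split => v /=; first by apply; split.
  by move=> Ev k /= [kJ /injf ->].
have mB s : measurable (B s).
  apply: fin_bigcap_measurable => //.
  by apply: (@sub_finite_set _ _ [set` J]); [move=> ? []|exact: finite_fset].
have := indF (J := (f @` J)%fset) (E := fun s => X s @^-1` B s).
move=> /(_ (fun s _ => @FX s _ (mB s))) H.
transitivity (P (\bigcap_(s in [set` (f @` J)%fset]) (X s @^-1` B s))).
  congr (P _); apply/seteqP; split => w /=.
    move=> h _ /= /imfsetP[j /= jJ ->]; rewrite BE//; exact: h.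
  move=> h j jJ; rewrite -BE//; apply: (h (f j)) => /=.
  by apply/imfsetP; exists j.
rewrite H big_imfset//=; apply: eq_big_seq => j jJ; by rewrite BE.
Qed.

(** Splitting [J] by the copy that [s] selects turns the event into a rectangle. Within one copy,
    injectivity of [s] is injectivity of its second component, so independence factors each side. *)
Lemma reindexed_copies_cylinder (s : bool * I -> bool * I)
    (J : {fset bool * I}) (E : bool * I -> set V) :
  injective s -> (forall j, measurable (E j)) ->
  (P \x P)%E [set z | forall j, j \in J -> E j (two_copies z (s j))] =
  (\prod_(j <- J) P (X (s j).2 @^-1` E j))%E.
Proof.
move=> injs mE.
pose Jb b := [fset j in J | (s j).1 == b]%fset.
pose A b := [set w | forall j, j \in Jb b -> E j (X (s j).2 w)].
have AE b : P (A b) = (\prod_(j <- Jb b) P (X (s j).2 @^-1` E j))%E.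
  apply: (independent_reindexed (f := fun j => (s j).2)) => // j k.
  rewrite !inE/= => /andP[_ /eqP j1] /andP[_ /eqP k1] jk; apply: injs.
  by rewrite (surjective_pairing (s j)) (surjective_pairing (s k)) j1 k1 jk.
have mA b : measurable (A b).
  rewrite (_ : A b = \bigcap_(j in [set` Jb b]) (X (s j).2 @^-1` E j)).
    apply: fin_bigcap_measurable; first exact: finite_fset.
    by move=> j _; rewrite -[X in measurable X]setTI; exact: mX.
  by apply/seteqP; split => w h j /= /h.
transitivity ((P \x P)%E (A false `*` A true)).
  congr (_ _); apply/seteqP; split => -[w1 w2] /=.
    move=> h; split => j; rewrite !inE/= => /andP[jJ /eqP sj];
      by have := h j jJ; rewrite /two_copies/= sj.
  move=> [h1 h2] j jJ; rewrite /two_copies/=.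
  by case sj: (s j).1; [apply: h2|apply: h1]; rewrite !inE/= jJ sj.
transitivity (P (A false) * P (A true))%E; first exact: product_measure1E.
rewrite !AE.
rewrite [RHS](big_fsetID _ [pred j | (s j).1 == false])/=.
rewrite (_ : [fset x | x in J & (s x).1 != false]%fset = Jb true)//.
by apply/fsetP => j; rewrite !inE/=; case: ((s j).1).
Qed.

(** Both sides have the same finite cylinder probabilities, products of equal marginals. It is used
    for the time shift and for the exchange of one clock between the copies. *)
Lemma reindexed_copies_law (s : bool * I -> bool * I)
    (A : set (config (bool * I)%type V)) :
  injective s ->
  (forall j B, measurable B ->
     P (X (s j).2 @^-1` B) = P (X j.2 @^-1` B)) ->
  measurable A ->
  (P \x P)%E [set z | A (fun j => two_copies z (s j))] =
  (P \x P)%E [set z | A (two_copies z)].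
Proof.
move=> injs Xs mA.
pose f1 z : config (bool * I)%type V := fun j => two_copies z (s j).
pose f2 z : config (bool * I)%type V := two_copies z.
have mf1 : measurable_fun setT f1 by exact: measurable_reindexed_copies.
have mf2 : measurable_fun setT f2.
  exact: (measurable_reindexed_copies id).
pose X1 : {mfun _ >-> _} := HB.pack f1 (isMeasurableFun.Build _ _ _ _ _ mf1).
pose X2 : {mfun _ >-> _} := HB.pack f2 (isMeasurableFun.Build _ _ _ _ _ mf2).
apply: (@config_measure_eq R _ _ _ (distribution (P \x P)%E X1)
  (distribution (P \x P)%E X2)) => // J E mE.
rewrite [LHS](reindexed_copies_cylinder J injs mE).
rewrite [RHS](reindexed_copies_cylinder J (@inj_id _) mE).
by apply: eq_bigr => j _; exact: Xs.
Qed.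

Lemma reindexed_copies_integral (s : bool * I -> bool * I)
    (g : config (bool * I)%type V -> \bar R) :
  injective s ->
  (forall j B, measurable B ->
     P (X (s j).2 @^-1` B) = P (X j.2 @^-1` B)) ->
  measurable_fun setT g -> (forall x, 0 <= g x)%E ->
  (\int[P \x P]_z g (fun j => two_copies z (s j)) =
   \int[P \x P]_z g (two_copies z))%E.
Proof.
move=> injs Xs mg g0.
have m1 := measurable_reindexed_copies s.
have m2 := measurable_reindexed_copies id.
have := @ge0_integral_pushforward _ _ _ _ _ _ m1 (P \x P)%E setT g
  measurableT mg (fun x _ => g0 x).
rewrite preimage_setT => <-.
have := @ge0_integral_pushforward _ _ _ _ _ _ m2 (P \x P)%E setT g
  measurableT mg (fun x _ => g0 x).
rewrite preimage_setT => <-.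
apply: eq_measure_integral => A mA _; exact: reindexed_copies_law.
Qed.

End IndependentCopies.

Section Marginals.
Context (R : realType) (d1 d2 : measure_display) (T1 : measurableType d1)
  (T2 : measurableType d2) (P1 : probability T1 R) (P2 : probability T2 R).

Lemma product_fst (A : set T1) : measurable A ->
  (P1 \x P2)%E [set z | A z.1] = P1 A.
Proof.
move=> mA; transitivity ((P1 \x P2)%E (A `*` setT)).
  by congr (_ _); apply/seteqP; split => z /=; [split|case].
rewrite product_measure1E//; rewrite [X in (_ * X)%E]probability_setT.
exact: mule1.
Qed.

Lemma product_snd (A : set T2) : measurable A ->
  (P1 \x P2)%E [set z | A z.2] = P2 A.
Proof.
move=> mA; transitivity ((P1 \x P2)%E (setT `*` A)).
  by congr (_ _); apply/seteqP; split => z /=; [split|case].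
rewrite product_measure1E//; rewrite [X in (X * _)%E]probability_setT.
exact: mul1e.
Qed.

Lemma integral_product_fst (g : T1 -> \bar R) : measurable_fun setT g ->
  (forall x, 0 <= g x)%E ->
  (\int[P1 \x P2]_z g z.1 = \int[P1]_x g x)%E.
Proof.
move=> mg g0; have mg1 : measurable_fun setT (fun z : T1 * T2 => g z.1).
  by apply: measurableT_comp => //; exact: measurable_fst.
rewrite fubini_tonelli1//; apply: eq_integral => x _.
rewrite /fubini_F/= integral_cst//.
by rewrite [X in (_ * X)%E]probability_setT mule1.
Qed.

End Marginals.

(** * Monotonicity of the dynamics *)

Section Boxes.
Context (d : nat).
Implicit Types i j : 'rV[int]_d.

Definition supnorm i : nat := (\max_(k < d) `|i 0%R k|)%N.

(** Boxes are enumerated by finite functions so that a sum of coordinatewise products over a box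
    becomes a product of one-dimensional sums. *)
Definition box_point (N : nat) (f : {ffun 'I_d -> 'I_N.*2.+1}) : 'rV[int]_d :=
  \row_k ((f k : nat)%:Z - N%:Z).

Definition box (N : nat) : seq 'rV[int]_d :=
  [seq @box_point N f | f <- enum {: {ffun 'I_d -> 'I_N.*2.+1}}].

Lemma box_point_inj N : injective (@box_point N).
Proof.
move=> f g /rowP fg; apply/ffunP => k; apply/val_inj => /=.
by have := fg k; rewrite !mxE => /(congr1 (fun x : int => x + N%:Z)); rewrite !subrK => -[].
Qed.

Lemma box_uniq N : uniq (box N).
Proof. by rewrite map_inj_uniq ?enum_uniq//; exact: box_point_inj. Qed.

Lemma mem_box N i : (i \in box N) = (supnorm i <= N)%N.
Proof.
apply/mapP/bigmax_leqP => [[f _ ->] k _|h].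
  by rewrite mxE; move: (f k : nat) (ltn_ord (f k)) => m; lia.
exists [ffun k => inord `|(i 0%R k + N%:Z)%R|%N]; first by rewrite mem_enum.
by apply/rowP => k; move: (h k isT); rewrite mxE ffunE; move: (i 0%R k) => m hm; rewrite inordK; lia.
Qed.

Lemma supnorm_le i n : (supnorm i <= n)%N <-> (forall k, (`|i 0%R k| <= n)%N).
Proof.
split=> [/bigmax_leqP h k|h]; [exact: h|exact/bigmax_leqP].
Qed.

End Boxes.

Section Dynamics.
Context (R : realType) (d : nat) (alg : algorithm) (a : 'rV[int]_d -> R).
Context (L : nat).
Hypothesis a0 : a 0 = 1.
Hypothesis age0 : forall i, 0 <= a i.
Hypothesis aL : forall i, 0 < a i -> (supnorm i <= L)%N.
Implicit Types (i j : 'rV[int]_d) (p : 'rV[int]_d -> R) (x y : state d)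
  (n : 'rV[int]_d -> nat) (u : 'rV[int]_d -> R).

(** A full box, in general larger than the set of neighbours; [a] vanishes on the surplus. *)
Definition nbhd i : seq 'rV[int]_d := [seq i + k | k <- box d L].

Lemma nbhd_uniq i : uniq (nbhd i).
Proof. by rewrite map_inj_uniq ?box_uniq//; exact: addrI. Qed.

Lemma mem_nbhd i j : 0 < a (j - i) -> j \in nbhd i.
Proof.
move=> /aL ji; apply/mapP; exists (j - i); first by rewrite mem_box.
by rewrite addrC subrK.
Qed.

Lemma nbhd_self i : i \in nbhd i.
Proof. by apply: mem_nbhd; rewrite subrr a0. Qed.

(** The list is left free because three choices occur: [nbhd L i], a box carrying the configuration,
    and [i] followed by its competitors. *)
Lemma psiE p i (J : seq 'rV[int]_d) : uniq J ->
  (forall j, 0 < a (j - i) -> p j != 0 -> j \in J) ->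
  psi a p i = p i / \sum_(j <- J) a (j - i) * p j.
Proof.
move=> uJ hJ; rewrite /psi (fsbigE J)//; last first.
  move=> j _ jJ.
  have [->|pj] := eqVneq (p j) 0; first by rewrite mulr0.
  have := age0 (j - i); rewrite le_eqVlt => /predU1P[<-|aj].
    by rewrite mul0r.
  by have := hJ _ aj pj; rewrite (negbTE jJ).
by congr (_ / _); apply: eq_bigl => j; rewrite in_setT.
Qed.

Lemma psi_nbhd p i :
  psi a p i = p i / \sum_(j <- nbhd i) a (j - i) * p j.
Proof. by apply: psiE (nbhd_uniq i) _ => j + _; exact: mem_nbhd. Qed.

Lemma load_ge p i : (forall j, 0 <= p j) ->
  p i <= \sum_(j <- nbhd i) a (j - i) * p j.
Proof.
move=> p0; rewrite (big_rem i) ?nbhd_self//= subrr a0 mul1r lerDl.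
by apply: sumr_ge0 => j _; rewrite mulr_ge0.
Qed.

Lemma psi_ge0 p i : (forall j, 0 <= p j) -> 0 <= psi a p i.
Proof.
move=> p0; rewrite psi_nbhd divr_ge0//.
by apply: sumr_ge0 => j _; rewrite mulr_ge0.
Qed.

Lemma psi_le1 p i : (forall j, 0 <= p j) -> psi a p i <= 1.
Proof.
move=> p0; rewrite psi_nbhd.
have := p0 i; rewrite le_eqVlt => /predU1P[<-|pi]; first by rewrite mul0r.
by rewrite ler_pdivrMr ?mul1r ?load_ge// (lt_le_trans pi (load_ge i p0)).
Qed.

Lemma psi_antimono p q i : (forall j, 0 <= p j) -> (forall j, p j <= q j) ->
  p i = q i -> psi a q i <= psi a p i.
Proof.
move=> p0 pq piqi; rewrite !psi_nbhd -piqi.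
have := p0 i; rewrite le_eqVlt => /predU1P[<-|pi]; first by rewrite !mul0r.
have Spi := lt_le_trans pi (load_ge i p0).
rewrite ler_wpM2l// lef_pV2 ?posrE//; last first.
  by apply: (lt_le_trans Spi); apply: ler_sum => j _; rewrite ler_wpM2l.
by apply: ler_sum => j _; rewrite ler_wpM2l.
Qed.

Lemma psi_local p q i : (forall j, j \in nbhd i -> p j = q j) ->
  psi a p i = psi a q i.
Proof.
move=> pq; rewrite !psi_nbhd pq ?nbhd_self//; congr (_ / _).
by apply: eq_big_seq => j /pq ->.
Qed.

(** The bound on [u i] makes - log u nonnegative; beyond 1 a longer queue would delay its clock. *)
Lemma tau_antimono x y u i : u i <= 1 -> (x i <= y i)%N ->
  (tau y u i <= tau x u i)%E.
Proof.
move=> ui xy; rewrite /tau.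
have [xi|xi] := eqVneq (x i) 0%N; first exact: leey.
have yi : y i != 0%N by apply: contraNneq xi => yi; move: xy; rewrite yi leqn0.
rewrite (negbTE yi) lee_wpmul2l//.
  by rewrite oppe_ge0 lne_le0 lee_fin.
by rewrite lee_fin lef_pV2 ?posrE ?ltr0n ?lt0n// ler_nat.
Qed.

Lemma transmits_antimono x y u i : (forall j, u j <= 1) ->
  (forall j, (x j <= y j)%N) -> x i = y i ->
  transmits alg a y u i -> transmits alg a x u i.
Proof.
move=> u1 xy xyi; rewrite /transmits -xyi => /andP[-> /=].
case: alg => [/asboolP h|h].
  apply/asboolP => j aj ji; rewrite (_ : tau x u i = tau y u i); last first.
    by rewrite /tau xyi.
  apply: (lt_le_trans (h j aj ji)); apply: lee_wpmul2r.
    by rewrite lee_fin invr_ge0.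
  exact: tau_antimono.
apply: (lt_le_trans h); apply: psi_antimono => //; last by rewrite xyi.
by move=> j; rewrite ler_nat.
Qed.

(** If [x i < y i], the departure of one job cannot reverse the order. If the two queues agree, [x]
    has weaker competitors, so [i] transmits from [x] whenever it does from [y]. *)
Lemma step_mono x y n m u i : (forall j, u j <= 1) ->
  (forall j, (x j <= y j)%N) -> (forall j, (n j <= m j)%N) ->
  (step alg a x n u i <= step alg a y m u i)%N.
Proof.
move=> u1 xy nm; rewrite /step.
have := xy i; rewrite leq_eqVlt => /predU1P[xyi|xyi]; last first.
  have := nm i; move: xyi; do 2 case: (transmits _ _ _ _ _) => /=; lia.
have := transmits_antimono u1 xy xyi; have := nm i; rewrite xyi.
case: (transmits alg a y u i) => [h /(_ isT) ->|h _] /=; first lia.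
case: (transmits _ _ _ _ _) => /=; lia.
Qed.

Lemma step_local x y n m u i : (forall j, j \in nbhd i -> x j = y j) ->
  n i = m i -> step alg a x n u i = step alg a y m u i.
Proof.
move=> xy nm; have xyi := xy _ (nbhd_self i).
rewrite /step nm xyi; congr (_ - nat_of_bool _)%N.
rewrite /transmits xyi; congr (_ && _); case: alg.
  apply: asbool_equiv_eq; split => h j aj ji; have := h j aj ji;
    by rewrite /tau xyi xy ?mem_nbhd.
by congr (_ < _); apply: psi_local => j /xy ->.
Qed.

Lemma step_le x n u i : (step alg a x n u i <= x i + n i)%N.
Proof. exact: leq_subr. Qed.

End Dynamics.

(** * Limits of nondecreasing integer sequences *)

Section EventualValue.

(** The attained maximum, which for a bounded nondecreasing sequence is its limit. The default 0 in
    the unbounded case keeps the limit total, so that boundedness is needed only almost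
    everywhere. *)
Definition eventual_value (g : nat -> nat) : nat :=
  xget 0%N [set m | (forall n, (g n <= m)%N) /\ exists n, g n = m].

Lemma eventual_valueE (g : nat -> nat) n0 m :
  {homo g : p q / (p <= q)%N} -> (forall n, (n0 <= n)%N -> g n = m) ->
  eventual_value g = m.
Proof.
move=> ndg gm; apply: xget_unique.
  split; last by exists n0; rewrite gm.
  by move=> n; rewrite -(gm (maxn n0 n)) ?leq_maxl// ndg// leq_maxr.
move=> q [q1 [q2 q3]]; apply/eqP; rewrite eqn_leq -{2}(gm _ (leqnn n0)) q1.
by rewrite -q3 -(gm (maxn n0 q2)) ?leq_maxl// ndg// leq_maxr.
Qed.

Lemma eventual_valueP (g : nat -> nat) M :
  {homo g : p q / (p <= q)%N} -> (forall n, (g n <= M)%N) ->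
  exists n0, forall n, (n0 <= n)%N -> g n = eventual_value g.
Proof.
move=> ndg gM.
suff [n0 n0P] : exists n0, forall n, (n0 <= n)%N -> g n = g n0.
  by exists n0 => n /n0P ->; rewrite (eventual_valueE ndg n0P).
have [n0 [n0M n0P]] : exists n0, (g n0 <= M)%N /\ forall n, (g n <= g n0)%N.
  have exg : exists m, `[< exists n, g n = m >].
    by exists (g 0%N); apply/asboolP; exists 0%N.
  have ubg m : `[< exists n, g n = m >] -> (m <= M)%N by move=> /asboolP[n <-].
  case: (ex_maxnP exg ubg) => m /asboolP[n <-] h; exists n; split => // p.
  by apply: h; apply/asboolP; exists p.
by exists n0 => n n0n; apply/eqP; rewrite eqn_leq n0P ndg.
Qed.

(** A positive level is taken iff it bounds the sequence and is attained, a countable condition.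
    Level 0 also absorbs the default value and is obtained as the complement of all the others. *)
Lemma measurable_eventual_value (dt : measure_display) (T : measurableType dt)
    (g : nat -> T -> nat) :
  (forall n, measurable_fun setT (g n)) ->
  measurable_fun setT (fun t => eventual_value (g ^~ t)).
Proof.
move=> mg.
pose f t := eventual_value (g ^~ t).
have fS m : f @^-1` [set m.+1] =
    (\bigcap_n (g n @^-1` [set k | (k <= m.+1)%N])) `&`
    (\bigcup_n (g n @^-1` [set m.+1])).
  apply/seteqP; split => t /=.
    rewrite /f /eventual_value; case: xgetP => // y -> [y1 [n y2]] <-.
    by split => [k _ //|]; [exact: y1|exists n].
  move=> [h [n _ gn]]; apply: xget_unique.
    by split => [k|]; [exact: h|exists n].
  move=> q [q1 [q2 q3]]; apply/eqP; rewrite eqn_leq -q3 (h q2)//= q3.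
  by rewrite -gn q1.
have mS m : measurable (f @^-1` [set m.+1]).
  rewrite fS; apply: measurableI.
    by apply: bigcapT_measurable => n; rewrite -[X in measurable X]setTI; exact: mg.
  by apply: bigcupT_measurable => n; rewrite -[X in measurable X]setTI; exact: mg.
have mE m : measurable (f @^-1` [set m]).
  case: m => // ; rewrite (_ : _ @^-1` _ = ~` \bigcup_m (f @^-1` [set m.+1])).
    by apply: measurableC; exact: bigcupT_measurable.
  apply/seteqP; split => t /=; first by move=> ft [m _ /=]; rewrite ft.
  move=> h; case E: (eventual_value (g ^~ t)) => [//|m].
  by case: h; exists m.
move=> _ A _; rewrite setTI (_ : _ @^-1` _ = \bigcup_(m in A) (f @^-1` [set m])).
  by apply: bigcup_measurable => m _; exact: mE.
by apply/seteqP; split => t /=; [move=> At; exists (f t)|move=> [m Am fm]; rewrite -/(f t) fm].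
Qed.

End EventualValue.

(** * The backward iteration and its limit *)

#[local] Arguments step : simpl never.

Section BackwardIteration.
Context (R : realType) (d : nat) (alg : algorithm) (a : 'rV[int]_d -> R).
Context (L : nat).
Hypothesis a0 : a 0 = 1.
Hypothesis age0 : forall i, 0 <= a i.
Hypothesis aL : forall i, 0 < a i -> (supnorm i <= L)%N.
Implicit Types (i j : 'rV[int]_d) (ns : nat -> 'rV[int]_d -> nat) (us : nat -> 'rV[int]_d -> R).

(* Truncated arrivals keep every queue bounded and all but finitely many empty,
   so that the Lyapunov function is a finite sum with finite mean. *)
Definition truncate (N : nat) (n : 'rV[int]_d -> nat) : 'rV[int]_d -> nat :=
  fun i => if (supnorm i <= N)%N then minn N (n i) else 0%N.

Lemma truncate_le N n i : (truncate N n i <= n i)%N.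
Proof. by rewrite /truncate; case: ifP => // _; exact: geq_minr. Qed.

Lemma truncate_bound N n i : (truncate N n i <= N)%N.
Proof. by rewrite /truncate; case: ifP => // _; exact: geq_minl. Qed.

Lemma truncate_mono N M n i : (N <= M)%N -> (truncate N n i <= truncate M n i)%N.
Proof.
move=> NM; rewrite /truncate; case: ifP => // iN.
by rewrite (leq_trans iN NM) leq_min geq_minr (leq_trans (geq_minl _ _) NM).
Qed.

Lemma truncate_id N n i : (supnorm i <= N)%N -> (n i <= N)%N ->
  truncate N n i = n i.
Proof. by move=> iN nN; rewrite /truncate iN; exact/minn_idPr. Qed.

(* Time is read backwards from time [t]: [ns t] and [us t] drive the last slot. *)
Fixpoint back (ns : nat -> 'rV[int]_d -> nat) (us : nat -> 'rV[int]_d -> R)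
    (N k t : nat) : state d :=
  if k is k'.+1 then
    step alg a (back ns us N k' t.+1) (truncate N (ns t)) (us t)
  else fun=> 0%N.

Lemma back_ext ns us ns' us' N k t t' :
  (forall s, (s < k)%N -> ns (t + s)%N = ns' (t' + s)%N) ->
  (forall s, (s < k)%N -> us (t + s)%N = us' (t' + s)%N) ->
  back ns us N k t = back ns' us' N k t'.
Proof.
elim: k t t' => //= k IHk t t' hns hus.
have := hns 0%N; rewrite !addn0 => -> //.
have := hus 0%N; rewrite !addn0 => -> //.
congr (step _ _ _ _ _); apply: IHk => s sk; rewrite !addSnnS.
  exact: hns.
exact: hus.
Qed.

Lemma back_bound ns us N k t i : (back ns us N k t i <= k * N)%N.
Proof.
elim: k t => //= k IHk t; rewrite (leq_trans (step_le _ _ _ _ _ _))//.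
by rewrite mulSn addnC leq_add// truncate_bound.
Qed.

Lemma back_support ns us N k t i : (N < supnorm i)%N ->
  back ns us N k t i = 0%N.
Proof.
move=> Ni; elim: k t => //= k IHk t; apply/eqP; rewrite -leqn0.
rewrite (leq_trans (step_le _ _ _ _ _ _))// IHk/= /truncate.
by rewrite ifN -?ltnNge.
Qed.

Section Bounded.
Context (ns : nat -> 'rV[int]_d -> nat) (us : nat -> 'rV[int]_d -> R).
Hypothesis us1 : forall t i, us t i <= 1.
Local Notation back := (back ns us).

(** An earlier start replaces the empty configuration at the old starting time by a larger one, and
    monotonicity of [step] carries the order forward. *)
Lemma back_monoS N k t i : (back N k t i <= back N k.+1 t i)%N.
Proof.
elim: k t i => // k IHk t i.
by rewrite /=; apply: (step_mono alg a0 age0 aL).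
Qed.

Lemma back_mono_trunc N M k t i : (N <= M)%N ->
  (back N k t i <= back M k t i)%N.
Proof.
move=> NM; elim: k t i => //= k IHk t i.
apply: (step_mono alg a0 age0 aL) => // j; exact: truncate_mono.
Qed.

Lemma back_mono N M k l t i : (N <= M)%N -> (k <= l)%N ->
  (back N k t i <= back M l t i)%N.
Proof.
move=> NM kl; rewrite (leq_trans (back_mono_trunc _ _ _ NM))//.
rewrite -(subnKC kl); elim: (l - k)%N => [|m IHm]; first by rewrite addn0.
by rewrite addnS (leq_trans IHm)// back_monoS.
Qed.

End Bounded.

(** A single index serves as truncation level and as number of slots, so that one monotone sequence
    per site handles both limits. *)
Definition loynes_bounded ns us : Prop :=
  forall i, exists M, forall n, (back ns us n n 0 i <= M)%N.

Definition loynes ns us : state d :=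
  fun i => eventual_value (fun n => back ns us n n 0 i).

Lemma loynesP ns us i : (forall t i, us t i <= 1) -> loynes_bounded ns us ->
  exists n0, forall n, (n0 <= n)%N -> back ns us n n 0 i = loynes ns us i.
Proof.
move=> us1 /(_ i)[M bM]; apply: eventual_valueP bM => p q pq.
exact: back_mono.
Qed.

Definition scons (T : Type) (x : T) (s : nat -> T) (t : nat) : T :=
  if t is t'.+1 then s t' else x.

(* At a given site the truncation is eventually inactive and the finitely many
   neighbouring queues eventually settle, so the recursion passes to the limit. *)
Lemma loynes_scons ns us n u :
  (forall t i, us t i <= 1) -> (forall i, u i <= 1) -> loynes_bounded ns us ->
  loynes (scons n ns) (scons u us) = step alg a (loynes ns us) n u.
Proof.
move=> us1 u1 bd; apply/funext => i.
have /choice[f fP] : forall j, exists n0, forall n, (n0 <= n)%N ->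
    back ns us n n 0 j = loynes ns us j by move=> j; exact: loynesP.
pose n0 := maxn (maxn (supnorm i) (n i)) (\max_(j <- nbhd L i) f j).
apply: (@eventual_valueE _ n0.+1) => [p q pq|[//|m]].
  by apply: back_mono => // -[|t] j /=.
rewrite ltnS !geq_max => /andP[/andP[im nim]] /bigmax_leqP_seq fm /=.
apply: (step_local alg a0 age0 aL); last by rewrite truncate_id ?(leq_trans _ (leqnSn m)).
move=> j ji; rewrite (@back_ext _ _ ns us _ _ _ 0)//.
have fjm := fm j ji isT.
(* Removing the newest slot leaves level [m.+1] with [m] slots, off the diagonal; it is squeezed
   between the diagonal terms [m] and [m.+1], which both equal the limit. *)
apply/eqP; rewrite eqn_leq; apply/andP; split.
  by rewrite -(fP j m.+1 (leq_trans fjm (leqnSn _))); exact: back_mono.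
by rewrite -(fP j m fjm); exact: back_mono.
Qed.

(** [queues] with the driving sequences as plain arguments, so that it can also be run on the
    two-copy noise. *)
Fixpoint trajectory (ns : nat -> 'rV[int]_d -> nat)
    (us : nat -> 'rV[int]_d -> R) (k : nat) (x : state d) : state d :=
  if k is k'.+1 then step alg a (trajectory ns us k' x) (ns k') (us k') else x.

Lemma queuesE (Omega : Type) (xi : nat -> 'rV[int]_d -> Omega -> nat)
    (U : nat -> 'rV[int]_d -> Omega -> R) k z :
  queues alg a xi U k z =
  trajectory (fun t i => xi t i z.2) (fun t i => U t i z.2) k z.1.
Proof. by elim: k => //= k ->. Qed.

Lemma trajectory_scons ns us n u k x :
  trajectory (scons n ns) (scons u us) k.+1 x =
  trajectory ns us k (step alg a x n u).
Proof. by elim: k => //= k ->. Qed.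

End BackwardIteration.

(** * Measurability *)

Section Measurability.
Context (R : realType) (d : nat) (alg : algorithm) (a : 'rV[int]_d -> R).
Context (L : nat).
Hypothesis a0 : a 0 = 1.
Hypothesis age0 : forall i, 0 <= a i.
Hypothesis aL : forall i, 0 < a i -> (supnorm i <= L)%N.
Context (dt : measure_display) (T : measurableType dt).

Lemma measurable_nat_comp (dt' : measure_display) (T' : measurableType dt')
    (F : nat -> T') (f : T -> nat) :
  measurable_fun setT f -> measurable_fun setT (F \o f).
Proof. by move=> mf; apply: measurableT_comp. Qed.

Lemma measurable_bool_comp (dt' : measure_display) (T' : measurableType dt')
    (F : bool -> T') (f : T -> bool) :
  measurable_fun setT f -> measurable_fun setT (F \o f).
Proof. by move=> mf; apply: measurableT_comp. Qed.

Lemma measurable_all (I : Type) (s : seq I) (f : I -> T -> bool) :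
  (forall j, measurable_fun setT (f j)) ->
  measurable_fun setT (fun t => all (f ^~ t) s).
Proof.
move=> mf; elim: s => [|j s IHs] /=; first exact: measurable_cst.
exact: measurable_and.
Qed.

Lemma measurable_lne_EFin (u : T -> R) : measurable_fun setT u ->
  measurable_fun setT (fun t => lne (u t)%:E).
Proof.
move=> mu; apply: measurable_fun_ifT => /=.
- by apply: measurable_fun_ler => //; exact: measurable_cst.
- exact: measurable_cst.
- by apply/measurable_EFinP; apply: measurableT_comp => //; exact: measurable_ln.
Qed.

(** A positive [x i] makes the load positive, so the quotient clears and the event is expressed by
    finitely many measurable operations. *)
Lemma transmits_D2E (x : state d) (u : 'rV[int]_d -> R) i :
  transmits D2 a x u i = (0 < x i)%N &&
    (u i * (\sum_(j <- nbhd L i) a (j - i) * (x j)%:R) < (x i)%:R).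
Proof.
rewrite /transmits; have [xi|//] /= := ltnP 0 (x i).
rewrite (psi_nbhd age0 aL) ltr_pdivlMr//.
rewrite (lt_le_trans _ (load_ge a0 age0 aL i _))//.
by rewrite ltr0n.
Qed.

Lemma transmits_D1E (x : state d) (u : 'rV[int]_d -> R) i :
  transmits D1 a x u i = (0 < x i)%N &&
    all (fun j => (0 < a (j - i)) && (j != i) ==>
      (tau x u i < tau x u j * ((a (j - i))^-1)%:E)%E) (nbhd L i).
Proof.
rewrite /transmits; congr (_ && _); apply/asboolP/allP => h j.
  by move=> _; apply/implyP => /andP[aj ji]; exact: h.
by move=> aj ji; have := h j (mem_nbhd aL aj); rewrite aj ji.
Qed.

Variables (x : T -> state d) (n : T -> 'rV[int]_d -> nat)
  (u : T -> 'rV[int]_d -> R).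
Hypothesis mx : forall i, measurable_fun setT (fun t => x t i).
Hypothesis mn : forall i, measurable_fun setT (fun t => n t i).
Hypothesis mu : forall i, measurable_fun setT (fun t => u t i).

Lemma measurable_tau i : measurable_fun setT (fun t => tau (x t) (u t) i).
Proof.
apply: measurable_fun_ifT => /=.
- exact: (measurable_nat_comp (fun k => k == 0%N)).
- exact: measurable_cst.
- apply: emeasurable_funM.
    by apply: measurableT_comp => //; exact: measurable_lne_EFin.
  exact: (measurable_nat_comp (fun k => (k%:R^-1)%:E : \bar R)).
Qed.

Lemma measurable_transmits i :
  measurable_fun setT (fun t => transmits alg a (x t) (u t) i).
Proof.
case: alg.
  under eq_fun do rewrite transmits_D1E.
  apply: measurable_and; first exact: (measurable_nat_comp (fun k => 0 < k)%N).
  apply: measurable_all => j; case: (_ && _) => /=; last exact: measurable_cst.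
  apply: measurable_fun_lte; first exact: measurable_tau.
  by apply: emeasurable_funM; [exact: measurable_tau|exact: measurable_cst].
under eq_fun do rewrite transmits_D2E.
apply: measurable_and; first exact: (measurable_nat_comp (fun k => 0 < k)%N).
apply: measurable_fun_ltr; last exact: (measurable_nat_comp (fun k => k%:R : R)).
apply: measurable_funM => //; apply: measurable_sum => j.
apply: measurable_funM; first exact: measurable_cst.
exact: (measurable_nat_comp (fun k => k%:R : R)).
Qed.

Lemma measurable_step i :
  measurable_fun setT (fun t => step alg a (x t) (n t) (u t) i).
Proof.
apply: measurable_fun_subn; first exact: measurable_fun_addn.
exact: (measurable_bool_comp nat_of_bool (measurable_transmits _)).
Qed.

Lemma measurable_truncate N i :
  measurable_fun setT (fun t => truncate N (n t) i).
Proof.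
rewrite /truncate; case: (supnorm i <= N)%N; last exact: measurable_cst.
exact: (measurable_nat_comp (minn N)).
Qed.

End Measurability.

Section MeasurableIteration.
Context (R : realType) (d : nat) (alg : algorithm) (a : 'rV[int]_d -> R).
Context (L : nat).
Hypothesis a0 : a 0 = 1.
Hypothesis age0 : forall i, 0 <= a i.
Hypothesis aL : forall i, 0 < a i -> (supnorm i <= L)%N.
Context (dt : measure_display) (T : measurableType dt).
Variables (ns : T -> nat -> 'rV[int]_d -> nat) (us : T -> nat -> 'rV[int]_d -> R).
Hypothesis mns : forall s i, measurable_fun setT (fun t => ns t s i).
Hypothesis mus : forall s i, measurable_fun setT (fun t => us t s i).

Lemma measurable_back N k s i :
  measurable_fun setT (fun t => back alg a (ns t) (us t) N k s i).
Proof.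
elim: k s i => [|k IHk] s i /=; first exact: measurable_cst.
by apply: (measurable_step alg a0 age0 aL) => // j; exact: measurable_truncate.
Qed.

Lemma measurable_loynes :
  measurable_fun setT (fun t => loynes alg a (ns t) (us t)).
Proof.
apply: (@measurable_to_config 'rV[int]_d _ nat) => i.
by apply: measurable_eventual_value => n; exact: measurable_back.
Qed.

Lemma measurable_trajectory (x : T -> state d) k :
  measurable_fun setT x ->
  measurable_fun setT (fun t => trajectory alg a (ns t) (us t) k (x t)).
Proof.
move=> mx; elim: k => [//|k IHk] /=.
apply: (@measurable_to_config 'rV[int]_d _ nat) => i.
apply: (measurable_step alg a0 age0 aL) => // j.
exact: (measurableT_comp (@measurable_coordinate 'rV[int]_d _ nat j) IHk).
Qed.

End MeasurableIteration.

(** * The Lyapunov drift *)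

Section Lyapunov.
Context (R : realType) (d : nat) (a : 'rV[int]_d -> R).
Context (L : nat).
Hypothesis a0 : a 0 = 1.
Hypothesis asym : forall i, a i = a (- i).
Hypothesis age0 : forall i, 0 <= a i.
Hypothesis aL : forall i, 0 < a i -> (supnorm i <= L)%N.
Implicit Types (i j : 'rV[int]_d) (B : seq 'rV[int]_d).

Lemma load_sub (p : 'rV[int]_d -> R) B i : uniq B -> (forall j, 0 <= p j) ->
  \sum_(j <- B) a (j - i) * p j <= \sum_(j <- nbhd L i) a (j - i) * p j.
Proof.
move=> uB p0.
rewrite (bigID (mem (nbhd L i)))/= [X in _ + X]big1_seq ?addr0; last first.
  move=> j /andP[jN _]; have := age0 (j - i).
  rewrite le_eqVlt => /predU1P[<-|/(mem_nbhd aL)]; first by rewrite mul0r.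
  by rewrite (negbTE jN).
rewrite -big_filter (perm_big [seq j <- nbhd L i | j \in B])/=; last first.
  apply: uniq_perm; rewrite ?filter_uniq ?nbhd_uniq// => j.
  by rewrite !mem_filter andbC.
rewrite big_filter big_mkcond/=; apply: ler_sum => j _.
by case: ifP => // _; rewrite mulr_ge0.
Qed.

Section Drift.
Context (B : seq 'rV[int]_d) (p nu lambda phi : 'rV[int]_d -> R) (c delta : R).
Context (x : 'rV[int]_d -> R).
Hypothesis uB : uniq B.
Hypothesis p0 : forall i, 0 <= p i.
Hypothesis nup : forall i, nu i <= psi a p i.
Hypothesis delta0 : 0 < delta.
Hypothesis lambda0 : forall i, 0 <= lambda i.
Hypothesis lambda_nu : forall i, lambda i + delta <= nu i.
Hypothesis phi0 : forall i, 0 < phi i.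
Hypothesis phic : forall i j, 0 < a (j - i) -> phi i <= c * phi j.
Hypothesis c_delta : c <= 1 + delta.
Hypothesis x0 : forall i, 0 <= x i.
Hypothesis xB : forall i, i \notin B -> x i = 0.

Lemma nu_gt0 i : 0 < nu i.
Proof. by have := delta0; have := lambda0 i; have := lambda_nu i; lra. Qed.

Lemma nu_le1 i : nu i <= 1.
Proof. exact: le_trans (nup i) (psi_le1 a0 age0 aL _ p0). Qed.

Let load i := \sum_(j <- B) a (j - i) * x j.

Lemma psi_load i : psi a x i = x i / load i.
Proof.
rewrite (psiE age0 uB)// => j _; apply: contraNT => jB; by rewrite xB.
Qed.

Lemma p_gt0 i : 0 < p i.
Proof.
rewrite lt_def p0 andbT; apply/eqP => pi.
by have := lt_le_trans (nu_gt0 i) (nup i); rewrite /psi pi mul0r ltxx.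
Qed.

(* AM-GM: [2 x^2 / nu <= x S + x^3 / (S nu^2)], where [psi x = x / S]. *)
Lemma site_drift i :
  x i ^+ 2 / nu i ^+ 2 * (nu i - psi a x i) <=
  x i * load i - x i ^+ 2 / nu i.
Proof.
have := x0 i; rewrite le_eqVlt => /predU1P[<-|xi].
  by rewrite expr0n/= !mul0r subr0.
have iB : i \in B by apply: contraLR xi => /xB ->; rewrite ltxx.
have Si : 0 < load i.
  rewrite /load (big_rem i)//= subrr a0 mul1r ltr_pwDl//.
  by apply: sumr_ge0 => j _; rewrite mulr_ge0.
have ni := nu_gt0 i.
rewrite psi_load -subr_ge0.
have -> : x i * load i - x i ^+ 2 / nu i -
    x i ^+ 2 / nu i ^+ 2 * (nu i - x i / load i) =
    x i * load i * (1 - x i / (load i * nu i)) ^+ 2.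
  by field; rewrite !gt_eqF.
by rewrite mulr_ge0 ?sqr_ge0// mulr_ge0// ltW.
Qed.

(** Schur test with vector [p]. Each product x_i x_j is split by AM-GM into [e i j] and a mirror
    term carrying the weight of the wrong site; moving that weight costs [c], whence the average (1
    + c) / 2. *)
Lemma weighted_load_le :
  \sum_(i <- B) phi i * (x i * load i) <=
  (1 + c) / 2 * \sum_(i <- B) phi i * (x i ^+ 2 / nu i).
Proof.
pose e i j := phi i * (a (j - i) * (x i ^+ 2 * (p j / p i))).
have c0 : 0 <= c.
  have := phic (i := 0) (j := 0); rewrite subr0 a0 ltr01 => /(_ isT) h.
  by have := le_trans (ltW (phi0 0)) h; rewrite pmulr_lge0.
have pair i j : phi i * (x i * (a (j - i) * x j)) <= 2^-1 * (e i j + c * e j i).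
  have := age0 (j - i); rewrite le_eqVlt => /predU1P[aji|aji].
    by rewrite /e -aji -[i - j]opprB -asym -aji !(mul0r, mulr0) addr0 mulr0.
  have aij : a (i - j) = a (j - i) by rewrite -opprB -asym.
  rewrite /e aij.
  have h1 : phi i * (a (j - i) * (x j ^+ 2 * (p i / p j))) <=
      c * (phi j * (a (j - i) * (x j ^+ 2 * (p i / p j)))).
    rewrite (mulrA c); apply: ler_wpM2r; last exact: phic.
    by rewrite mulr_ge0// mulr_ge0 ?sqr_ge0// divr_ge0.
  apply: (@le_trans _ _ (2^-1 * (phi i * (a (j - i) * (x i ^+ 2 * (p j / p i))) +
      phi i * (a (j - i) * (x j ^+ 2 * (p i / p j)))))); last first.
    by rewrite ler_pM2l ?invr_gt0 ?ltr0n// lerD2l.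
  have pi := p_gt0 i; have pj := p_gt0 j.
  rewrite -subr_ge0.
  have -> : 2^-1 * (phi i * (a (j - i) * (x i ^+ 2 * (p j / p i))) +
      phi i * (a (j - i) * (x j ^+ 2 * (p i / p j)))) -
      phi i * (x i * (a (j - i) * x j)) =
      2^-1 * phi i * a (j - i) / (p i * p j) * (x i * p j - x j * p i) ^+ 2.
    by field; rewrite !gt_eqF.
  rewrite mulr_ge0 ?sqr_ge0// divr_ge0 ?mulr_ge0// ?invr_ge0 ?ler0n//; exact: ltW.
(* The row sum of [e] carries the ratio of the load of [p] to [p i], at most 1 / nu_i because
   [nu i <= psi a p i]. *)
have eB : \sum_(i <- B) \sum_(j <- B) e i j <=
    \sum_(i <- B) phi i * (x i ^+ 2 / nu i).
  apply: ler_sum => i _; rewrite /e -mulr_sumr ler_pM2l//.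
  have -> : \sum_(j <- B) a (j - i) * (x i ^+ 2 * (p j / p i)) =
      x i ^+ 2 * ((\sum_(j <- B) a (j - i) * p j) / p i).
    rewrite mulrA mulr_sumr mulr_suml; apply: eq_bigr => j _; ring.
  rewrite ler_wpM2l ?sqr_ge0// ler_pdivrMr ?p_gt0//.
  apply: (le_trans (load_sub _ uB p0)).
  have := nup i; rewrite (psi_nbhd age0 aL).
  have T0 : 0 < \sum_(j <- nbhd L i) a (j - i) * p j.
    exact: lt_le_trans (p_gt0 i) (load_ge a0 age0 aL i p0).
  by rewrite ler_pdivlMr// mulrC -ler_pdivlMr ?nu_gt0// mulrC.
have -> : \sum_(i <- B) phi i * (x i * load i) =
    \sum_(i <- B) \sum_(j <- B) phi i * (x i * (a (j - i) * x j)).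
  by apply: eq_bigr => i _; rewrite /load !mulr_sumr.
apply: (@le_trans _ _ (\sum_(i <- B) \sum_(j <- B) 2^-1 * (e i j + c * e j i))).
  by apply: ler_sum => i _; apply: ler_sum => j _; exact: pair.
have -> : \sum_(i <- B) \sum_(j <- B) 2^-1 * (e i j + c * e j i) =
    (1 + c) / 2 * \sum_(i <- B) \sum_(j <- B) e i j.
  under eq_bigr => i _ do rewrite -mulr_sumr big_split/=.
  rewrite -mulr_sumr big_split/= [X in _ + X]exchange_big/=.
  under [X in _ + X]eq_bigr => i _ do rewrite -mulr_sumr.
  by rewrite -mulr_sumr; field.
by rewrite ler_wpM2l// divr_ge0// addr_ge0.
Qed.

(** The gap between [lambda] and [nu] yields - delta times the weighted sum of x^2 / nu^2. The
    weights lose at most (c - 1) / 2 times the sum of x^2 / nu, hence half of the gain, since c - 1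
    <= delta and nu <= 1. *)
Lemma quadratic_drift :
  \sum_(i <- B) phi i / nu i ^+ 2 * (x i ^+ 2 * (lambda i - psi a x i)) <=
  - (delta / 2) * \sum_(i <- B) phi i / nu i ^+ 2 * x i ^+ 2.
Proof.
have step1 : \sum_(i <- B) phi i / nu i ^+ 2 * (x i ^+ 2 * (lambda i - psi a x i))
    <= - delta * (\sum_(i <- B) phi i / nu i ^+ 2 * x i ^+ 2) +
       (\sum_(i <- B) phi i * (x i * load i) -
        \sum_(i <- B) phi i * (x i ^+ 2 / nu i)).
  rewrite -sumrB mulr_sumr -big_split/=; apply: ler_sum => i _.
  have := site_drift i; have := lambda_nu i; move: (phi0 i) (nu_gt0 i).
  set l := load i; set s := psi a x i => ph n ln h.
  have -> : phi i / nu i ^+ 2 * (x i ^+ 2 * (lambda i - s)) =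
     phi i * (x i ^+ 2 / nu i ^+ 2 * (nu i - s)) +
     phi i / nu i ^+ 2 * x i ^+ 2 * (lambda i - nu i) by ring.
  rewrite [leLHS]addrC; apply: lerD.
    rewrite [leRHS]mulrC; apply: ler_wpM2l; last by lra.
    by rewrite mulr_ge0 ?sqr_ge0// divr_ge0 ?exprn_ge0// ltW.
  by rewrite -mulrBr ler_pM2l.
apply: (le_trans step1).
have step2 : \sum_(i <- B) phi i * (x i ^+ 2 / nu i) <=
    \sum_(i <- B) phi i / nu i ^+ 2 * x i ^+ 2.
  apply: ler_sum => i _; have ni := nu_gt0 i.
  have -> : phi i * (x i ^+ 2 / nu i) = phi i / nu i ^+ 2 * x i ^+ 2 * nu i.
    by field; rewrite gt_eqF.
  rewrite ler_piMr ?nu_le1// mulr_ge0 ?sqr_ge0// divr_ge0 ?exprn_ge0// ltW//.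
move: weighted_load_le step2; set S1 := \sum_(i <- B) _ * (_ * _).
set S2 := \sum_(i <- B) _ * (_ / _); set S3 := \sum_(i <- B) _ => h1 h2.
have S20 : 0 <= S2.
  apply: sumr_ge0 => i _; rewrite mulr_ge0 ?(ltW (phi0 _))//.
  by rewrite divr_ge0 ?sqr_ge0// ltW// nu_gt0.
have h3 : (1 + c) / 2 * S2 - S2 <= delta / 2 * S3.
  have -> : (1 + c) / 2 * S2 - S2 = (c - 1) / 2 * S2 by field.
  apply: (@le_trans _ _ (delta / 2 * S2)).
    by apply: ler_wpM2r => //; have := c_delta; lra.
  by apply: ler_wpM2l => //; have := delta0; lra.
lra.
Qed.

(** Three times [quadratic_drift] gives - 3 delta / 2. One delta / 2 is kept in the conclusion; the
    remaining - delta x^2 absorbs 3 (M + 1) x by completing the square, which produces 9 (M + 1)^2 /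
    (4 delta). As nu >= delta, the weights phi / nu^2 of the constant term are at most phi /
    delta^2. *)
Lemma cubic_drift (M : R) : 0 <= M ->
  \sum_(i <- B) phi i / nu i ^+ 2 *
     (x i ^+ 3 + 3 * x i ^+ 2 * lambda i + 3 * x i * (M + 1) + M) +
  delta / 2 * \sum_(i <- B) phi i / nu i ^+ 2 * x i ^+ 2 <=
  \sum_(i <- B) phi i / nu i ^+ 2 * x i ^+ 3 +
  \sum_(i <- B) phi i / nu i ^+ 2 * (3 * x i ^+ 2 * psi a x i) +
  (M + 9 * (M + 1) ^+ 2 / (4 * delta)) * \sum_(i <- B) phi i / delta ^+ 2.
Proof.
move=> M0; set K := M + 9 * _ / _.
have K0 : 0 <= K.
  by rewrite addr_ge0// divr_ge0 ?mulr_ge0 ?exprn_ge0 ?addr_ge0// ltW.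
pose w i := phi i / nu i ^+ 2.
have w0 i : 0 <= w i by rewrite divr_ge0 ?exprn_ge0// ltW// nu_gt0.
have wK : \sum_(i <- B) w i * K <= K * \sum_(i <- B) phi i / delta ^+ 2.
  rewrite mulr_sumr; apply: ler_sum => i _; rewrite mulrC ler_wpM2l//.
  rewrite /w ler_pM2l// lef_pV2 ?posrE ?exprn_gt0 ?nu_gt0//.
  rewrite lerXn2r ?nnegrE ?(ltW delta0) ?(ltW (nu_gt0 _))//.
  by have := delta0; have := lambda0 i; have := lambda_nu i; lra.
have Kx i : - (3 * (delta / 2)) * x i ^+ 2 + delta / 2 * x i ^+ 2 +
    3 * x i * (M + 1) + M <= K.
  rewrite -subr_ge0 (_ : _ - _ = (delta * x i - 3 * (M + 1) / 2) ^+ 2 / delta).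
    by rewrite divr_ge0 ?sqr_ge0 ?ltW.
  by rewrite /K; field; rewrite gt_eqF.
have := quadratic_drift; rewrite -/w => Q.
have E1 : \sum_(i <- B) w i * (x i ^+ 3 + 3 * x i ^+ 2 * lambda i +
    3 * x i * (M + 1) + M) =
    \sum_(i <- B) w i * x i ^+ 3 +
    \sum_(i <- B) w i * (3 * x i ^+ 2 * psi a x i) +
    3 * (\sum_(i <- B) w i * (x i ^+ 2 * (lambda i - psi a x i))) +
    \sum_(i <- B) w i * (3 * x i * (M + 1) + M).
  rewrite mulr_sumr -!big_split/=; apply: eq_bigr => i _; ring.
have E2 : \sum_(i <- B) w i * (3 * x i * (M + 1) + M) <=
    \sum_(i <- B) w i * K + (3 * (delta / 2) - delta / 2) *
      \sum_(i <- B) w i * x i ^+ 2.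
  rewrite mulr_sumr -big_split/=; apply: ler_sum => i _.
  have -> : w i * K + (3 * (delta / 2) - delta / 2) * (w i * x i ^+ 2) =
    w i * (K + (3 * (delta / 2) - delta / 2) * x i ^+ 2) by ring.
  apply: ler_wpM2l => //; have := Kx i; lra.
rewrite -/w E1; move: Q E2 wK; rewrite -/w.
move: (\sum_(i <- B) _) (\sum_(i <- B) _) (\sum_(i <- B) _) (\sum_(i <- B) _)
  (\sum_(i <- B) _) (\sum_(i <- B) _) (K * _) => s1 s2 s3 s4 s5 s6 s7.
lra.
Qed.

End Drift.

End Lyapunov.

(** * Summable weights of slow spatial variation *)

Section GeometricWeights.
Context (R : realType) (d : nat).

Lemma bernoulli_sub (e : R) (m : nat) : 0 <= e <= 1 ->
  1 - m%:R * e <= (1 - e) ^+ m.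
Proof.
move=> /andP[e0 e1]; elim: m => [|m IHm]; first by rewrite mul0r subr0.
rewrite exprS; apply: (@le_trans _ _ ((1 - e) * (1 - m%:R * e))).
  rewrite -subr_ge0 -natr1.
  have -> : (1 - e) * (1 - m%:R * e) - (1 - (m%:R + 1) * e) = m%:R * e ^+ 2.
    by ring.
  by rewrite mulr_ge0// sqr_ge0.
by rewrite ler_wpM2l// subr_ge0.
Qed.

Lemma geometric_sum_le (q : R) (n : nat) : 0 <= q < 1 ->
  \sum_(i < n) q ^+ i <= (1 - q)^-1.
Proof.
move=> /andP[q0 q1]; have q1' : 0 < 1 - q by rewrite subr_gt0.
rewrite -[leRHS]mul1r ler_pdivlMr// mulrC.
by rewrite -opprB mulNr -subrX1 opprB gerBl exprn_ge0.
Qed.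

Lemma geometric_box_sum_le (q : R) (N : nat) : 0 <= q < 1 ->
  \sum_(i < N.*2.+1) q ^+ `|i%:Z - N%:Z|%N <= 2 / (1 - q).
Proof.
move=> q01.
rewrite -(big_mkord xpredT (fun i => q ^+ `|i%:Z - N%:Z|%N)).
rewrite (@big_cat_nat _ _ _ N.+1)//=; last by rewrite ltnS -addnn leq_addr.
rewrite mulr2n mulrDl mul1r; apply: lerD.
  rewrite big_nat_rev/= add0n big_mkord.
  apply: le_trans (geometric_sum_le N.+1 q01); apply: ler_sum => i _.
  rewrite le_eqVlt; apply/orP; left; apply/eqP; congr (_ ^+ _).
  by move: (ltn_ord i); lia.
rewrite -{1}[N.+1]add0n big_addn big_mkord.
(* This half starts at exponent 1; the missing term q^0 is added to reach a full geometric sum. *)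
apply: (le_trans _ (geometric_sum_le (N.*2.+1 - N.+1).+1 q01)).
rewrite [leRHS]big_ord_recl; rewrite -[leLHS]add0r; apply: lerD => //.
apply: ler_sum => i _; rewrite le_eqVlt; apply/orP; left; apply/eqP.
by congr (_ ^+ _); rewrite /= /bump /=; lia.
Qed.

(* Summable weights that are nearly constant over the interaction range: they
   localize the Lyapunov function at the cost of a factor [c] close to 1. *)
Lemma geometric_weights (L : nat) (delta : R) : 0 < delta ->
  exists (phi : 'rV[int]_d -> R) (c Phi : R),
  [/\ forall i, 0 < phi i,
      forall i j, (supnorm (j - i) <= L)%N -> phi i <= c * phi j,
      c <= 1 + delta &
      forall N, \sum_(i <- box d N) phi i <= Phi].
Proof.
move=> delta0; pose m := (d * L)%N.
(* Chosen so that 1 - (m + 1) e = 1 / (1 + delta): Bernoulli then bounds q^m below by 1 / (1 +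
   delta), where [m] bounds the l1 distance of two sites within range [L]. Taking [m.+1] covers m =
   0. *)
pose e := delta / ((1 + delta) * m.+1%:R).
have d1 : 0 < 1 + delta by rewrite addr_gt0.
have m0 : 0 < m.+1%:R :> R by rewrite ltr0n.
have e0 : 0 < e by rewrite divr_gt0// mulr_gt0.
have e1 : e < 1.
  rewrite ltr_pdivrMr ?mulr_gt0// mul1r.
  apply: (@lt_le_trans _ _ (1 + delta)); first by rewrite ltrDr.
  by rewrite ler_peMr ?(ltW d1)// ler1n.
pose q := 1 - e.
have q0 : 0 < q by rewrite subr_gt0.
have q1 : q < 1 by rewrite gtrBl.
have q01 : 0 <= q < 1 by rewrite q1 ltW.
have qm : (1 + delta)^-1 <= q ^+ m.
  apply: le_trans (bernoulli_sub m _); last by rewrite !ltW.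
  rewrite -subr_ge0.
  have -> : 1 - m%:R * e - (1 + delta)^-1 = e.
    by rewrite /e -natr1; field; rewrite natr1 !gt_eqF.
  exact: ltW.
(* The l1 norm makes the weight a product over coordinates, so that its sum over a box factors. *)
pose l1 (i : 'rV[int]_d) := (\sum_(k < d) `|i 0%R k|)%N.
exists (fun i => q ^+ l1 i), (q ^- m), ((2 / (1 - q)) ^+ d); split.
- by move=> i; rewrite exprn_gt0.
- move=> i j ji; rewrite -ler_pdivrMl ?invr_gt0 ?exprn_gt0// invrK -exprD.
  apply: ler_wiXn2l; rewrite ?ltW//.
  have -> : m = (\sum_(k < d) L)%N by rewrite sum_nat_const card_ord.
  rewrite -big_split/=; apply: leq_sum => k _.
  have := (supnorm_le (j - i) L).1 ji k; rewrite !mxE.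
  by move: (i 0%R k) (j 0%R k) => x y; lia.
- by rewrite -[leRHS]invrK lef_pV2 ?posrE ?exprn_gt0 ?invr_gt0.
- move=> N; rewrite /box big_map big_enum/=.
  pose F (k : 'I_d) (j : 'I_N.*2.+1) := q ^+ `|(j : nat)%:Z - N%:Z|%N.
  rewrite (eq_bigr (fun f : {ffun 'I_d -> 'I_N.*2.+1} => \prod_k F k (f k))).
    rewrite -(bigA_distr_bigA F) -[d in leRHS]card_ord -prodr_const.
    apply: ler_prod => k _; rewrite geometric_box_sum_le// andbT.
    by apply: sumr_ge0 => i _; rewrite exprn_ge0// ltW.
  move=> f _; rewrite /l1 /F expr_sum; apply: eq_bigr => k _.
  by rewrite mxE.
Qed.

End GeometricWeights.

(** * Service probabilities *)

Section UniformLaw.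
Context (R : realType).

Lemma uniform_prob_lt (t : R) : 0 <= t <= 1 ->
  uniform_prob (@ltr01 R) [set u | u < t] = t%:E.
Proof.
move=> /andP[t0 t1]; rewrite /uniform_prob integral_uniform_pdf.
rewrite (_ : _ `&` _ = `[0, t[%classic); last first.
  apply/seteqP; split => u /=; rewrite !in_itv/=.
    by move=> [-> /andP[->]].
  by move=> /andP[u0 ut]; rewrite ut u0 (le_trans (ltW ut)).
rewrite (eq_integral (cst 1%E)); last first.
  move=> u; rewrite inE/= in_itv/= => /andP[u0 ut].
  by rewrite /uniform_pdf u0 (le_trans (ltW ut) t1) subr0 invr1.
rewrite integral_cst//= mul1e lebesgue_measure_itv/= lte_fin.
case: ltP => [_|t0']; first by rewrite oppr0 adde0.
by have -> : t = 0 by apply/le_anti; rewrite t0 t0'.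
Qed.

Lemma integral_powR01 (c : R) : 0 <= c ->
  (\int[lebesgue_measure]_(u in `[0%R, 1%R]) (u `^ c)%:E = ((1 + c)^-1)%:E)%E.
Proof.
(* For c = 0 the integrand tends to 1 at the origin, not to 0, so this case is treated apart. *)
rewrite le_eqVlt => /predU1P[<-|c0].
  under eq_integral do rewrite powRr0.
  by rewrite integral_cst//= lebesgue_measure_itv/= lte_fin ltr01 oppr0 adde0 mule1 addr0 invr1.
have c1 : 0 < 1 + c by rewrite addr_gt0.
have pow0 (b : R) : 0 < b -> u `^ b @[u --> 0^'+] --> (0 : R) `^ b.
  by move=> b0; rewrite powR0 ?gt_eqF//; exact: powR_cvg0.
have powc (b u : R) : 0 < u -> {for u, continuous (fun v : R => v `^ b)}.
  move=> u0; apply: differentiable_continuous; apply/derivable1_diffP.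
  by apply: derivable_powR; rewrite in_itv/= u0.
pose F := fun u : R => (1 + c)^-1 * u `^ (1 + c).
rewrite (@continuous_FTC2 _ (fun u => u `^ c) F)//.
- by rewrite /F powR1 powR0 ?gt_eqF// mulr1 mulr0 sube0.
- apply/continuous_within_itvP => //; split.
  + by move=> u; rewrite in_itv/= => /andP[u0 _]; exact: powc.
  + exact: pow0.
  + by apply: cvg_at_left_filter; exact: powc.
- split.
  + move=> u; rewrite in_itv/= => /andP[u0 _]; apply: derivableM => //.
    by apply: derivable_powR; rewrite in_itv/= u0.
  + by apply: cvgM; [exact: cvg_cst|exact: pow0].
  + apply: cvgM; first exact: cvg_cst.
    by apply: cvg_at_left_filter; exact: powc.
- move=> u; rewrite in_itv/= => /andP[u0 _].
  rewrite derive1E deriveM//; last by apply: derivable_powR; rewrite in_itv/= u0.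
  rewrite derive_cst scaler0 addr0 -derive1E powR_derive1 ?in_itv/= ?u0//.
  by rewrite addrAC subrr add0r /GRing.scale/= mulrA mulVf ?mul1r// gt_eqF.
Qed.

Lemma integral_uniform_powR (c : R) : 0 <= c ->
  (\int[uniform_prob (@ltr01 R)]_u (if 0 < u then u `^ c else 0)%R%:E =
   ((1 + c)^-1)%:E)%E.
Proof.
move=> c0.
have mg : measurable_fun setT (fun u : R => if 0 < u then u `^ c else 0).
  apply: measurable_fun_ifT.
  - exact: (measurable_fun_ltr (measurable_cst (0 : R)) (@measurable_id _ _ _)).
  - exact: measurable_powR.
  - exact: measurable_cst.
rewrite integral_uniform//=; last 2 first.
- exact/measurable_EFinP.
- by move=> u; case: ifP => // _; rewrite lee_fin powR_ge0.
rewrite subr0 invr1 mul1e -(integral_powR01 c0).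
rewrite -!(@integral_itv_obnd_cbnd _ 0 (BRight 1)).
- apply: eq_integral => u; rewrite inE/= in_itv/= => /andP[-> _] //.
- apply/measurable_EFinP; apply: measurable_funTS; exact: measurable_powR.
- by apply/measurable_EFinP; apply: measurable_funTS.
Qed.

End UniformLaw.

Section Noise.
Context (R : realType) (d : nat) (dd : measure_display)
  (Omega : measurableType dd) (P : probability Omega R).
Context (xi : nat -> 'rV[int]_d -> {RV P >-> nat})
  (U : nat -> 'rV[int]_d -> {RV P >-> R}) (lambda : 'rV[int]_d -> R).
Hypothesis hdr : driving xi U lambda.

Definition noise_index : choiceType :=
  ((nat * 'rV[int]_d) + (nat * 'rV[int]_d))%type.

(* All driving variables share one value type; the other component is a dummy. *)
Definition noise (s : noise_index) (w : Omega) : (nat * R)%type :=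
  match s with
  | inl (k, i) => (xi k i w, 0)
  | inr (k, i) => (0%N, U k i w)
  end.

Lemma measurable_noise s : measurable_fun setT (noise s).
Proof.
case: s => -[k i] /=.
  by apply: measurable_fun_pair => //; exact: measurable_cst.
by apply: measurable_fun_pair => //; exact: measurable_cst.
Qed.

Lemma noise_sigma s B : measurable B -> driving_sigma xi U s (noise s @^-1` B).
Proof.
case: s => -[k i] mB /=.
  exists ((fun n => (n, 0 : R)) @^-1` B); last by rewrite setTI.
  rewrite -[X in measurable X]setTI; exact: pair2_measurable.
exists ((fun u : R => (0%N, u)) @^-1` B); last by rewrite setTI.
rewrite -[X in measurable X]setTI; exact: pair1_measurable.
Qed.

Lemma noise_indep : mutually_independent P (driving_sigma xi U).
Proof. by case: hdr. Qed.

Lemma noise_arrival_law k i B : measurable B ->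
  P (noise (inl (k, i)) @^-1` B) = P (noise (inl (0%N, i)) @^-1` B).
Proof.
move=> mB; case: hdr => _ hxi _ _.
exact: (congr1 (fun m : set nat -> \bar R => m ((fun n => (n, 0 : R)) @^-1` B)) (hxi k i)).
Qed.

Lemma noise_service_law k i B : measurable B ->
  P (noise (inr (k, i)) @^-1` B) = P (noise (inr (0%N, i)) @^-1` B).
Proof.
move=> mB; case: hdr => _ _ _ hU.
have mB' : measurable ((fun u : R => (0%N, u)) @^-1` B).
  rewrite -[X in measurable X]setTI; exact: pair1_measurable.
exact: (etrans (hU k i _ mB') (esym (hU 0%N i _ mB'))).
Qed.

Lemma uniform_lt k i (t : R) : 0 <= t <= 1 -> P [set w | U k i w < t] = t%:E.
Proof.
move=> t01; case: hdr => _ _ _ hU; rewrite -(uniform_prob_lt t01).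
by rewrite -(hU k i)//; exact: measurable_itv `]-oo, t[.
Qed.

Definition noise_config := config (bool * noise_index)%type (nat * R)%type.

Definition arrivals_of (b : bool) (Z : noise_config) (k : nat)
  (i : 'rV[int]_d) : nat := fst (Z (b, inl (k, i))).

Definition clocks_of (b : bool) (Z : noise_config) (k : nat)
  (i : 'rV[int]_d) : R := snd (Z (b, inr (k, i))).

Lemma measurable_arrivals_of b k i :
  measurable_fun setT (fun Z => arrivals_of b Z k i).
Proof.
apply: measurableT_comp; first exact: measurable_fst.
exact: measurable_coordinate.
Qed.

Lemma measurable_clocks_of b k i :
  measurable_fun setT (fun Z => clocks_of b Z k i).
Proof.
apply: measurableT_comp; first exact: measurable_snd.
exact: measurable_coordinate.
Qed.

Section Service.
Context (a : 'rV[int]_d -> R) (L : nat).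
Hypothesis a0 : a 0 = 1.
Hypothesis age0 : forall i, 0 <= a i.
Hypothesis aL : forall i, 0 < a i -> (supnorm i <= L)%N.

Lemma service_D2 (x : state d) k i :
  P [set w | transmits D2 a x (fun j => U k j w) i] =
  (psi a (fun j => (x j)%:R) i)%:E.
Proof.
have x0 j : 0 <= (x j)%:R :> R by [].
have [xi0|xi0] := eqVneq (x i) 0%N.
  rewrite /psi xi0 mul0r (_ : [set _ | _] = set0) ?measure0//.
  by apply/seteqP; split => // w /=; rewrite /transmits xi0.
rewrite -(uniform_lt k i); last first.
  by rewrite (psi_ge0 age0 aL) ?(psi_le1 a0 age0 aL).
congr (P _); apply/seteqP; split => w /=; rewrite /transmits lt0n xi0//.
Qed.

(* The clock of site [i] is redrawn from an independent copy, so that by Fubini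
   the race can be decided conditionally on it. *)
Lemma race_prob (J : {fset 'rV[int]_d}) (c : 'rV[int]_d -> R) k i :
  (forall w, U k i w <= 1) -> i \notin J -> (forall j, 0 <= c j) ->
  P [set w | 0 < U k i w /\
    forall j, j \in J -> U k j w < U k i w `^ c j] =
  ((1 + \sum_(j <- J) c j)^-1)%:E.
Proof.
move=> U1 iJ c0.
pose s0 : noise_index := inr (k, i).
(* Exchanges the two copies of the clock of [i] and fixes everything else: afterwards that clock is
   read at [z.1], its rivals at [z.2]. *)
pose s (b : bool * noise_index) : bool * noise_index :=
  if b.2 == s0 then (~~ b.1, b.2) else b.
pose A : set noise_config := [set Z | (0 < clocks_of true Z k i) &&
  all (fun j => clocks_of true Z k j < clocks_of true Z k i `^ c j) J].
have mA : measurable A.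
  have mb : measurable_fun setT (fun Z => (0 < clocks_of true Z k i) &&
      all (fun j => clocks_of true Z k j < clocks_of true Z k i `^ c j) J).
    apply: measurable_and.
      apply: measurable_fun_ltr; first exact: measurable_cst.
      exact: measurable_clocks_of.
    apply: measurable_all => j; apply: measurable_fun_ltr.
      exact: measurable_clocks_of.
    exact: (measurableT_comp (@measurable_powR R (c j)) (measurable_clocks_of _ _ _)).
  by rewrite -[A]setTI; exact: (mb _ [set true]).
have sinj : injective s.
  have sK : cancel s s.
    move=> [b r]; rewrite /s/=; have [->|rs] := eqVneq r s0 => /=.
      by rewrite eqxx negbK.
    by rewrite (negbTE rs).
  exact: can_inj sK.
have s2 j : (s j).2 = j.2 by rewrite /s; case: ifP.
have sE : s (true, s0) = (false, s0) by rewrite /s/= eqxx.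
have sJ j : j \in J -> s (true, inr (k, j)) = (true, inr (k, j)).
  move=> jJ; rewrite /s ifF//; apply/eqP => -[] ji.
  by rewrite -ji jJ in iJ.
clearbody s.
have law := reindexed_copies_law measurable_noise noise_sigma noise_indep sinj
  _ mA.
have AP Z : A Z <-> 0 < clocks_of true Z k i /\
    forall j, j \in J -> clocks_of true Z k j < clocks_of true Z k i `^ c j.
  have -> : A Z = ((0 < clocks_of true Z k i) &&
    all (fun j => clocks_of true Z k j < clocks_of true Z k i `^ c j) J) :> Prop by [].
  split=> [/andP[h /allP h']|[h h']]; first by split; [exact: h|exact: h'].
  by apply/andP; split; [exact: h|apply/allP; exact: h'].
clearbody A.
have AE z : A (two_copies noise z) <-> 0 < U k i z.2 /\
    forall j, j \in J -> U k j z.2 < U k i z.2 `^ c j by exact: AP.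
set ev := [set w | _].
have mev : measurable ev.
  have m2 : measurable_fun setT (fun w => two_copies noise (w, w) :
      config (bool * noise_index)%type (nat * R)%type).
    by apply: measurable_to_config => -[[] r]; exact: measurable_noise.
  rewrite (_ : ev = (fun w => two_copies noise (w, w)) @^-1` A).
    by rewrite -[X in measurable X]setTI; exact: m2.
  by apply/seteqP; split => w /=; rewrite (AE (w, w)).
transitivity ((P \x P)%E [set z | A (two_copies noise z)]).
  rewrite -(product_snd P P mev).
  by congr (_ _); apply/seteqP; split => z /=; rewrite (AE z).
rewrite -law; last first.
  by move=> j B mB; rewrite s2.
set A' := [set z | _].
have A'P z : A' z <-> 0 < U k i z.1 /\
    forall j, j \in J -> U k j z.2 < U k i z.1 `^ c j.
  have iE : clocks_of true (fun j => two_copies noise z (s j)) k i = U k i z.1.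
    by rewrite /clocks_of -/s0 sE.
  have jE j : j \in J ->
      clocks_of true (fun j => two_copies noise z (s j)) k j = U k j z.2.
    by move=> jJ; rewrite /clocks_of sJ.
  rewrite /A'/= AP iE.
  by split=> -[h h']; split => // j jJ; have := h' j jJ; rewrite jE.
(* Given the clock u of [i], the rivals are independent and each loses with probability u^(c j), so
   the exponents add up. *)
have A'E w1 : P (xsection A' w1) =
    (if 0 < U k i w1 then U k i w1 `^ (\sum_(j <- J) c j) else 0)%:E.
  have [t0|t0] := ltP 0 (U k i w1); last first.
    have -> : xsection A' w1 = set0; last exact: measure0.
    rewrite -subset0 => w2; rewrite /xsection/= inE => /A'P[/= + _].
    by rewrite ltNge t0.
  pose E (j : 'rV[int]_d) : set (nat * R) := 
    [set v | (snd v : R) < U k i w1 `^ c j].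
  transitivity (P [set w2 | forall j, j \in J -> E j (noise (inr (k, j)) w2)]).
    congr (P _); apply/seteqP; split => w2; rewrite /xsection/= inE.
      by move=> /A'P[].
    by move=> h; apply/A'P; split.
  have mE j : measurable (E j).
    have mb : measurable_fun setT
        (fun v : nat * R => (snd v : R) < U k i w1 `^ c j).
      by apply: measurable_fun_ltr; [exact: measurable_snd|exact: measurable_cst].
    by rewrite -[E j]setTI; exact: (mb measurableT [set true]).
  rewrite (independent_reindexed noise_sigma noise_indep (f := fun j => inr (k, j)) _ mE); last first.
    by move=> j1 j2 _ _ [].
  rewrite (eq_bigr (fun j => (U k i w1 `^ c j)%:E)); last first.
    move=> j _; rewrite -(uniform_lt k j)//.
    rewrite powR_ge0/=.
    by rewrite -(powRr0 (U k i w1)) ger_powR ?t0 ?U1.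
  rewrite prodEFin; congr (_%:E).
  elim: (enum_fset J) => [|j r IHr]; first by rewrite !big_nil powRr0.
  rewrite !big_cons IHr powRD//; apply/implyP => _; exact: lt0r_neq0.
transitivity (\int[P]_w1 P (xsection A' w1))%E; first by [].
under eq_integral do rewrite A'E.
have C0 : 0 <= \sum_(j <- J) c j by exact: sumr_ge0.
rewrite -(integral_uniform_powR C0).
pose g (u : R) : \bar R := (if 0 < u then u `^ \sum_(j <- J) c j else 0)%:E.
have mg : measurable_fun setT g.
  apply/measurable_EFinP; apply: measurable_fun_ifT.
  - exact: (measurable_fun_ltr (measurable_cst (0 : R)) (@measurable_id _ _ _)).
  - exact: measurable_powR.
  - exact: measurable_cst.
have mX : measurable_fun setT (U k i : Omega -> measurableTypeR R).
  exact: (measurable_funPT (U k i)).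
pose X : {RV P >-> measurableTypeR R} :=
  HB.pack (U k i : Omega -> measurableTypeR R) (isMeasurableFun.Build _ _ _ _ _ mX).
transitivity (\int[distribution P X]_u g u)%E.
  rewrite (@ge0_integral_distribution _ _ _ _ _ P X g)//.
  by move=> u; rewrite lee_fin; case: ifP => // _; exact: powR_ge0.
apply: (@eq_measure_integral _ _ R setT (uniform_prob (@ltr01 R))
  (distribution P X) g) => B mB _.
by case: hdr => _ _ _; exact.
Qed.

(** Taking logarithms turns the hypothesis into the comparison of clocks. A rival with an empty
    queue or with [u j <= 0] has an infinite clock. *)
Lemma race_transmits (x : state d) (u : 'rV[int]_d -> R) i :
  (0 < x i)%N -> 0 < u i ->
  (forall j, 0 < a (j - i) -> j != i ->
     u j < u i `^ (a (j - i) * (x j)%:R / (x i)%:R)) ->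
  transmits D1 a x u i.
Proof.
move=> xi0 ui0 h; rewrite /transmits xi0; apply/asboolP => j aj ji.
have xiR : 0 < (x i)%:R :> R by rewrite ltr0n.
have -> : tau x u i = (- ln (u i) / (x i)%:R)%:E.
  by rewrite /tau gtn_eqF// lne_EFin// EFinM EFinN.
rewrite /tau; have [xj0|xj0] := eqVneq (x j) 0%N.
  by rewrite gt0_mulye ?ltry// lte_fin invr_gt0.
have xjR : 0 < (x j)%:R :> R by rewrite ltr0n lt0n.
have [uj0|uj0] := leP (u j) 0.
  by rewrite le0_lneNy ?lee_fin//= !gt0_mulye ?ltry// lte_fin invr_gt0.
rewrite lne_EFin// -EFinN -!EFinM lte_fin.
have := h j aj ji; rewrite -ltr_ln ?posrE ?powR_gt0// ln_powR => hj.
rewrite !mulNr ltrN2 -ltr_pdivlMr ?invr_gt0// invrK.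
rewrite ltr_pdivrMr//; apply: (lt_le_trans hj).
by rewrite le_eqVlt; apply/orP; left; apply/eqP; field; rewrite gt_eqF.
Qed.

(** Under [D1] the load divided by [x i] is 1 plus the sum of the exponents [c j], so [psi] is the
    probability given by [race_prob]. An inequality is enough for the drift and spares an analysis
    of ties and infinite clocks. *)
Lemma service_ge alg (x : state d) k i : (forall j w, U k j w <= 1) ->
  ((psi a (fun j => (x j)%:R) i)%:E <=
   P [set w | transmits alg a x (fun j => U k j w) i])%E.
Proof.
move=> U1; case: alg; last by rewrite service_D2.
have [xi0|xi0] := posnP (x i); first by rewrite /psi xi0 mul0r measure_ge0.
pose J := [fset j in nbhd L i | (0 < a (j - i)) && (j != i)]%fset.
pose c j : R := a (j - i) * (x j)%:R / (x i)%:R.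
have iJ : i \notin J by rewrite !inE/= eqxx !andbF.
have inJ j : (j \in J) = (0 < a (j - i)) && (j != i).
  rewrite !inE/=; case: (boolP (0 < a (j - i))) => [aj|_]; last by rewrite andbF.
  by rewrite (mem_nbhd aL).
have c0 j : 0 <= c j by rewrite divr_ge0// mulr_ge0.
have xiR : 0 < (x i)%:R :> R by rewrite ltr0n.
have -> : psi a (fun j => (x j)%:R) i = (1 + \sum_(j <- J) c j)^-1.
  rewrite (psiE age0 (J := i :: enum_fset J)); last 2 first.
  - by rewrite cons_uniq iJ fset_uniq.
  - by move=> j aj _; rewrite inE; case: eqVneq => //= ji; rewrite inJ aj ji.
  rewrite big_cons subrr a0 mul1r -mulr_suml.
  have S0 : 0 <= \sum_(j <- J) a (j - i) * (x j)%:R.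
    by apply: sumr_ge0 => j _; rewrite mulr_ge0.
  by field; rewrite !gt_eqF// ltr_pwDl.
rewrite -(race_prob (k := k) (U1 i) iJ c0); apply: le_measure; rewrite ?inE.
- have mb : measurable_fun setT (fun w => (0 < U k i w) &&
      all (fun j => U k j w < U k i w `^ c j) J).
    apply: measurable_and.
      by apply: measurable_fun_ltr => //; exact: measurable_cst.
    apply: measurable_all => j; apply: measurable_fun_ltr => //.
    exact: (measurableT_comp (@measurable_powR R (c j)) (measurable_funPT (U k i))).
  rewrite (_ : [set _ | _] = setT `&` (fun w => (0 < U k i w) &&
      all (fun j => U k j w < U k i w `^ c j) J) @^-1` [set true]).
    exact: mb.
  rewrite setTI; apply/seteqP; split => w /=.
    by move=> [h h']; apply/andP; split; [exact: h|apply/allP; exact: h'].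
  by move=> /andP[h /allP h']; split; [exact: h|exact: h'].
- have mb : measurable_fun setT
      (fun w => transmits D1 a x (fun j => U k j w) i).
    apply: (measurable_transmits D1 a0 age0 aL (x := fun=> x)) => j.
      exact: measurable_cst.
    exact: (measurable_funPT (U k j)).
  by rewrite -[X in measurable X]setTI; exact: (mb measurableT [set true]).
- move=> w [h h']; apply: race_transmits => // j aj ji.
  by apply: h'; rewrite inJ aj.
Qed.

End Service.
End Noise.

(** * Shift invariance and moment bounds *)

Section Shift.
Context (R : realType) (d : nat).

(** [(true, k)] stands for slot k and [(false, k)] for slot - k - 1; the map adds 1 to the slot. *)
Definition shift_time (c : bool * nat) : bool * nat :=
  match c with
  | (false, 0%N) => (true, 0%N)
  | (false, k.+1) => (false, k)
  | (true, k) => (true, k.+1)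
  end.

(* The two copies of the noise are glued into a doubly infinite sequence: copy
   [false] read backwards is the past, copy [true] is the future. *)
Definition shift (c : bool * noise_index d) : bool * noise_index d :=
  match c with
  | (b, inl (k, i)) => ((shift_time (b, k)).1, inl ((shift_time (b, k)).2, i))
  | (b, inr (k, i)) => ((shift_time (b, k)).1, inr ((shift_time (b, k)).2, i))
  end.

Lemma shift_inj : injective shift.
Proof.
by move=> [[] [[[|k] i]|[[|k] i]]] [[] [[[|l] j]|[[|l] j]]] //= [] *; subst.
Qed.

Lemma arrivals_of_shift_past (Z : noise_config R d) :
  arrivals_of false (fun c => Z (shift c)) =
  scons (arrivals_of true Z 0) (arrivals_of false Z).
Proof. by apply/funext => -[|k]; apply/funext. Qed.

Lemma clocks_of_shift_past (Z : noise_config R d) :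
  clocks_of false (fun c => Z (shift c)) =
  scons (clocks_of true Z 0) (clocks_of false Z).
Proof. by apply/funext => -[|k]; apply/funext. Qed.

Lemma back_scons alg (a : 'rV[int]_d -> R) ns us n u N k :
  back alg a (scons n ns) (scons u us) N k.+1 0 =
  step alg a (back alg a ns us N k 0) (truncate N n) u.
Proof. by rewrite /= (@back_ext _ _ _ _ _ _ ns us _ _ _ 0). Qed.

End Shift.

Section ShiftLaw.
Context (R : realType) (d : nat) (alg : algorithm) (a : 'rV[int]_d -> R).
Context (L : nat).
Hypothesis a0 : a 0 = 1.
Hypothesis age0 : forall i, 0 <= a i.
Hypothesis aL : forall i, 0 < a i -> (supnorm i <= L)%N.
Context (dd : measure_display) (Omega : measurableType dd)
  (P : probability Omega R).
Context (xi : nat -> 'rV[int]_d -> {RV P >-> nat})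
  (U : nat -> 'rV[int]_d -> {RV P >-> R}) (lambda : 'rV[int]_d -> R).
Hypothesis hdr : driving xi U lambda.

Definition arrivals (w : Omega) (t : nat) (i : 'rV[int]_d) : nat := xi t i w.
Definition clocks (w : Omega) (t : nat) (i : 'rV[int]_d) : R := U t i w.
Definition past_queue (N k : nat) (w : Omega) : state d :=
  back alg a (arrivals w) (clocks w) N k 0.

Lemma shift_law (c : bool * noise_index d) B : measurable B ->
  P (noise xi U (shift c).2 @^-1` B) = P (noise xi U c.2 @^-1` B).
Proof.
move=> mB; case: c => b [[k i]|[k i]].
  by rewrite [RHS](noise_arrival_law hdr k i mB) [LHS](noise_arrival_law hdr _ i mB).
by rewrite [RHS](noise_service_law hdr k i mB) [LHS](noise_service_law hdr _ i mB).
Qed.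

Lemma shift_measure (A : set (noise_config R d)) : measurable A ->
  (P \x P)%E [set z | A (fun c => two_copies (noise xi U) z (shift c))] =
  (P \x P)%E [set z | A (two_copies (noise xi U) z)].
Proof.
move=> mA; apply: reindexed_copies_law mA.
- exact: measurable_noise.
- exact: noise_sigma.
- exact: noise_indep hdr.
- exact: shift_inj.
- exact: shift_law.
Qed.

Lemma shift_integral (g : noise_config R d -> \bar R) :
  measurable_fun setT g -> (forall x, 0 <= g x)%E ->
  (\int[P \x P]_z g (fun c => two_copies (noise xi U) z (shift c)) =
   \int[P \x P]_z g (two_copies (noise xi U) z))%E.
Proof.
move=> mg g0; apply: reindexed_copies_integral mg g0.
- exact: measurable_noise.
- exact: noise_sigma.
- exact: noise_indep hdr.
- exact: shift_inj.
- exact: shift_law.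
Qed.

Lemma measurable_past_queue N k i :
  measurable_fun setT (fun w => past_queue N k w i).
Proof.
apply: (measurable_back alg a0 age0 aL) => s j; exact: measurable_funPT.
Qed.

Lemma measurable_next_queue N k i :
  measurable_fun setT (fun z : Omega * Omega =>
    step alg a (past_queue N k z.1) (truncate N (arrivals z.2 0))
      (clocks z.2 0) i).
Proof.
apply: (measurable_step alg a0 age0 aL (x := fun z => past_queue N k z.1)
  (n := fun z => truncate N (arrivals z.2 0)) (u := fun z => clocks z.2 0)) => j.
- apply: (measurableT_comp (measurable_past_queue N k j)); exact: measurable_fst.
- apply: (measurable_truncate (n := fun z => arrivals z.2 0)) => j'.
  exact: (measurableT_comp (measurable_funPT (xi 0%N j')) measurable_snd).
- exact: (measurableT_comp (measurable_funPT (U 0%N j)) measurable_snd).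
Qed.

(** After the shift the newest past slot is slot 0 of the second copy, hence independent of the
    older slots, which remain in the first; Fubini then separates the two. *)
Lemma past_queue_step_law N k (G : state d -> \bar R) :
  measurable_fun setT G -> (forall x, 0 <= G x)%E ->
  (\int[P]_w G (past_queue N k.+1 w) =
   \int[P]_w1 \int[P]_w2 G (step alg a (past_queue N k w1)
      (truncate N (arrivals w2 0)) (clocks w2 0)))%E.
Proof.
move=> mG G0.
pose B m (Z : noise_config R d) : state d :=
  back alg a (arrivals_of false Z) (clocks_of false Z) N m 0.
have mB m : measurable_fun setT (B m).
  apply: (@measurable_to_config 'rV[int]_d _ nat) => i.
  apply: (measurable_back alg a0 age0 aL) => s j.
    exact: measurable_arrivals_of.
  exact: measurable_clocks_of.
have mY : measurable_fun setT (past_queue N k.+1).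
  by apply: (@measurable_to_config 'rV[int]_d _ nat) => i; exact: measurable_past_queue.
rewrite -(@integral_product_fst _ _ _ _ _ P P (fun w => G (past_queue N k.+1 w)));
  [|exact: measurableT_comp|by []].
transitivity (\int[P \x P]_z (G \o B k.+1) (two_copies (noise xi U) z))%E.
  by apply: eq_integral.
rewrite -shift_integral; [|exact: measurableT_comp|by move=> x /=].
transitivity (\int[P \x P]_z (fun z => G (step alg a (past_queue N k z.1)
   (truncate N (arrivals z.2 0)) (clocks z.2 0))) z)%E.
  apply: eq_integral => z _ /=.
  by rewrite /B arrivals_of_shift_past clocks_of_shift_past back_scons.
rewrite fubini_tonelli1//.
apply: measurableT_comp => //.
apply: (@measurable_to_config 'rV[int]_d _ nat) => i; exact: measurable_next_queue.
Qed.

End ShiftLaw.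

(** * Third moments over one slot *)

Section MomentBound.
Context (R : realType) (d : nat) (alg : algorithm) (a : 'rV[int]_d -> R).
Context (L : nat).
Hypothesis a0 : a 0 = 1.
Hypothesis age0 : forall i, 0 <= a i.
Hypothesis aL : forall i, 0 < a i -> (supnorm i <= L)%N.
Context (dd : measure_display) (Omega : measurableType dd)
  (P : probability Omega R).
Context (xi : nat -> 'rV[int]_d -> {RV P >-> nat})
  (U : nat -> 'rV[int]_d -> {RV P >-> R}) (lambda : 'rV[int]_d -> R).
Hypothesis hdr : driving xi U lambda.
Hypothesis U1 : forall k i w, U k i w <= 1.
Context (M : R).
Hypothesis xiM : forall i, (\int[P]_w ((xi 0%N i w)%:R ^+ 3)%:E <= M%:E)%E.

Local Notation arrivals := (arrivals xi).
Local Notation clocks := (clocks U).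

(** Expansion of the cube, with [n] the truncated and [m] the full arrivals. The service term 3 x^2
    t stays on the left, to be averaged separately; lower powers are absorbed through n^2 <= m^3,
    valid for integers. *)
Lemma cube_step_le (x n m : nat) (t : bool) : (n <= m)%N -> (t -> 0 < x)%N ->
  ((x + n - t)%:R ^+ 3 + 3 * x%:R ^+ 2 * t%:R <=
   (x%:R ^+ 3 + 3 * x%:R) + 3 * x%:R ^+ 2 * m%:R + (3 * x%:R + 1) * m%:R ^+ 3
   :> R)%R.
Proof.
move=> nm tx.
have X0 : 0 <= x%:R :> R by [].
have n0 : 0 <= n%:R :> R by [].
have h1 : n%:R <= m%:R :> R by rewrite ler_nat.
have h3 : n%:R ^+ 3 <= m%:R ^+ 3 :> R by rewrite lerXn2r ?nnegrE.
have h2 : n%:R ^+ 2 <= m%:R ^+ 3 :> R.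
  rewrite -!natrX ler_nat (leq_trans (_ : _ <= m ^ 2)%N) ?leq_exp2r//.
  by case: m {nm h1 h3} => // m; rewrite [leqRHS]expnS leq_pmull.
have h4 : x%:R ^+ 2 * n%:R <= x%:R ^+ 2 * m%:R :> R by rewrite ler_wpM2l ?exprn_ge0.
have h5 : x%:R * n%:R ^+ 2 <= x%:R * m%:R ^+ 3 :> R by rewrite ler_wpM2l.
case: t tx => [/(_ isT) x1|_] /=.
  rewrite natrB ?natrD; last by rewrite (leq_trans x1)// leq_addr.
  move: (x%:R : R) (n%:R : R) (m%:R : R) (m%:R ^+ 3 : R) X0 n0 h1 h2 h3 h4 h5.
  move=> X N M1 M3 X0 N0 h1 h2 h3 h4 h5.
  have h6 : 0 <= X * N by rewrite mulr_ge0.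
  have h7 : (N - 1) ^+ 3 <= N ^+ 3.
    rewrite -subr_ge0 (_ : _ - _ = 3 * (N - 2^-1) ^+ 2 + 4^-1); last by field.
    by rewrite addr_ge0 ?invr_ge0// mulr_ge0// sqr_ge0.
  have -> : (X + N - 1) ^+ 3 + 3 * X ^+ 2 * 1 =
    X ^+ 3 + 3 * (X ^+ 2 * N) + 3 * (X * N ^+ 2) - 6 * (X * N) + 3 * X + (N - 1) ^+ 3.
    by ring.
  have -> : (3 * X + 1) * M3 = 3 * (X * M3) + M3 by ring.
  have -> : 3 * X ^+ 2 * M1 = 3 * (X ^+ 2 * M1) by ring.
  lra.
rewrite subn0 natrD mulr0 addr0.
move: (x%:R : R) (n%:R : R) (m%:R : R) (m%:R ^+ 3 : R) X0 n0 h1 h2 h3 h4 h5.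
move=> X N M1 M3 X0 N0 h1 h2 h3 h4 h5.
have -> : (X + N) ^+ 3 = X ^+ 3 + 3 * (X ^+ 2 * N) + 3 * (X * N ^+ 2) + N ^+ 3.
  by ring.
have -> : (3 * X + 1) * M3 = 3 * (X * M3) + M3 by ring.
have -> : 3 * X ^+ 2 * M1 = 3 * (X ^+ 2 * M1) by ring.
lra.
Qed.

Lemma integral_arrival i : (\int[P]_w ((xi 0%N i w)%:R)%:E = (lambda i)%:E)%E.
Proof. by case: hdr => _ _ + _ => /(_ 0%N i); rewrite unlock. Qed.

Lemma measurable_step_noise N x i : measurable_fun setT (fun w =>
  step alg a x (truncate N (arrivals w 0)) (clocks w 0) i).
Proof.
apply: (measurable_step alg a0 age0 aL (x := fun=> x)
  (n := fun w => truncate N (arrivals w 0)) (u := fun w => clocks w 0)) => j.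
- exact: measurable_cst.
- by apply: (measurable_truncate (n := fun w => arrivals w 0)) => j'; exact: measurable_funPT.
- exact: measurable_funPT.
Qed.

(** Mean of [cube_step_le], with the service probability bounded below by [psi]. The factor M + 1
    collects 3 x from the service and 3 x M from the arrivals. *)
Lemma site_moment N (x : state d) i :
  (\int[P]_w ((step alg a x (truncate N (arrivals w 0)) (clocks w 0) i)%:R ^+ 3)%:E
    + (3 * (x i)%:R ^+ 2 * psi a (fun j => (x j)%:R) i)%:E <=
  ((x i)%:R ^+ 3 + 3 * (x i)%:R ^+ 2 * lambda i + 3 * (x i)%:R * (M + 1) + M)%:E)%E.
Proof.
pose X : R := (x i)%:R.
have X0 : 0 <= X by [].
pose s w := step alg a x (truncate N (arrivals w 0)) (clocks w 0) i.
have ms : measurable_fun setT (fun w => ((s w)%:R ^+ 3 : R)%:E).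
  apply: (measurable_nat_comp (fun k => (k%:R ^+ 3 : R)%:E)).
  exact: measurable_step_noise.
pose tr w := transmits alg a x (clocks w 0) i.
have mtr : measurable_fun setT tr.
  apply: (measurable_transmits alg a0 age0 aL (x := fun=> x)
    (u := fun w => clocks w 0)) => j; first exact: measurable_cst.
  exact: measurable_funPT.
have mT : measurable [set w | tr w].
  by rewrite -[X in measurable X]setTI; exact: (mtr measurableT [set true]).
have mx1 : measurable_fun setT (fun w => ((xi 0%N i w)%:R : R)%:E).
  exact: (measurable_nat_comp (fun k => (k%:R : R)%:E) (measurable_funPT (xi 0%N i))).
have mx3 : measurable_fun setT (fun w => ((xi 0%N i w)%:R ^+ 3 : R)%:E).
  exact: (measurable_nat_comp (fun k => (k%:R ^+ 3 : R)%:E) (measurable_funPT (xi 0%N i))).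
have c2 : 0 <= 3 * X ^+ 2 by rewrite mulr_ge0 ?exprn_ge0.
have c3 : 0 <= 3 * X + 1 by rewrite addr_ge0// mulr_ge0.
apply: (@le_trans _ _ (\int[P]_w (((s w)%:R ^+ 3)%:E + (3 * X ^+ 2)%:E * (\1_[set w | tr w] w)%:E)))%E.
  rewrite ge0_integralD//; last 2 first.
  - by move=> w _; rewrite -EFinM lee_fin mulr_ge0.
  - by apply: emeasurable_funM; [exact: measurable_cst|exact/measurable_EFinP/measurable_indic].
  apply: leeD => //.
  rewrite ge0_integralZl_EFin//; last first.
    exact/measurable_EFinP/measurable_indic.
  rewrite integral_indic// setIT EFinM; apply: lee_pmul => //.
  - by rewrite lee_fin; exact: (psi_ge0 age0 aL).
  - exact: (service_ge hdr a0 age0 aL).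
apply: (@le_trans _ _ (\int[P]_w ((X ^+ 3 + 3 * X)%:E + (3 * X ^+ 2)%:E * ((xi 0%N i w)%:R)%:E
    + (3 * X + 1)%:E * ((xi 0%N i w)%:R ^+ 3)%:E)))%E.
  apply: ge0_le_integral => //.
  - by move=> w _; rewrite -EFinM -EFinD lee_fin addr_ge0 ?exprn_ge0// mulr_ge0.
  - apply: emeasurable_funD => //; apply: emeasurable_funM; first exact: measurable_cst.
    exact/measurable_EFinP/measurable_indic.
  - apply: emeasurable_funD; last by apply: emeasurable_funM => //; exact: measurable_cst.
    apply: emeasurable_funD; first exact: measurable_cst.
    by apply: emeasurable_funM => //; exact: measurable_cst.
  - move=> w _; rewrite -!EFinM -!EFinD lee_fin.
    have -> : \1_[set w | tr w] w = (tr w)%:R :> R.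
      rewrite indicE; case: (boolP (tr w)) => trw; first by rewrite mem_set.
      by rewrite memNset//=; exact/negP.
    rewrite /s /step /X; apply: cube_step_le; first exact: truncate_le.
    by rewrite /tr/transmits => /andP[].
rewrite ge0_integralD//; last 4 first.
- by move=> w _; rewrite -EFinM -EFinD lee_fin addr_ge0 ?mulr_ge0 ?addr_ge0 ?exprn_ge0 ?mulr_ge0.
- apply: emeasurable_funD; first exact: measurable_cst.
  by apply: emeasurable_funM => //; exact: measurable_cst.
- by move=> w _; rewrite -EFinM lee_fin mulr_ge0 ?exprn_ge0.
- by apply: emeasurable_funM => //; exact: measurable_cst.
rewrite ge0_integralD//; last 3 first.
- by move=> w _; rewrite lee_fin addr_ge0 ?exprn_ge0 ?mulr_ge0.
- by move=> w _; rewrite -EFinM lee_fin mulr_ge0 ?exprn_ge0.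
- by apply: emeasurable_funM => //; exact: measurable_cst.
rewrite integral_cst// [X in (_ * X)%E]probability_setT mule1.
rewrite ge0_integralZl_EFin// integral_arrival.
rewrite ge0_integralZl_EFin//.
apply: (@le_trans _ _ ((X ^+ 3 + 3 * X)%:E + (3 * X ^+ 2)%:E * (lambda i)%:E +
  (3 * X + 1)%:E * M%:E))%E.
  by apply: leeD => //; apply: lee_pmul => //; apply: integral_ge0 => w _;
    rewrite lee_fin exprn_ge0.
rewrite -!EFinM -!EFinD lee_fin -/X; lra.
Qed.

End MomentBound.

(** * Second moments uniform in truncation and time *)

Section SecondMoment.
Context (R : realType) (d : nat) (alg : algorithm) (a : 'rV[int]_d -> R).
Context (L : nat).
Hypothesis a0 : a 0 = 1.
Hypothesis asym : forall i, a i = a (- i).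
Hypothesis age0 : forall i, 0 <= a i.
Hypothesis aL : forall i, 0 < a i -> (supnorm i <= L)%N.
Context (dd : measure_display) (Omega : measurableType dd)
  (P : probability Omega R).
Context (xi : nat -> 'rV[int]_d -> {RV P >-> nat})
  (U : nat -> 'rV[int]_d -> {RV P >-> R}) (lambda : 'rV[int]_d -> R).
Hypothesis hdr : driving xi U lambda.
Hypothesis U1 : forall k i w, U k i w <= 1.
Context (M : R).
Hypothesis M0 : 0 <= M.
Hypothesis xiM : forall i, (\int[P]_w ((xi 0%N i w)%:R ^+ 3)%:E <= M%:E)%E.
Context (p nu : 'rV[int]_d -> R) (delta : R).
Hypothesis p0 : forall i, 0 <= p i.
Hypothesis nup : forall i, nu i <= psi a p i.
Hypothesis delta0 : 0 < delta.
Hypothesis lambda0 : forall i, 0 <= lambda i.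
Hypothesis lambda_nu : forall i, lambda i + delta <= nu i.

Local Notation arrivals := (arrivals xi).
Local Notation clocks := (clocks U).
Local Notation past_queue := (past_queue alg a xi U).

Section Weighted.
Context (phi : 'rV[int]_d -> R) (c Phi : R).
Hypothesis phi0 : forall i, 0 < phi i.
Hypothesis phic : forall i j, (supnorm (j - i) <= L)%N -> phi i <= c * phi j.
Hypothesis c_delta : c <= 1 + delta.
Hypothesis phiPhi : forall N, \sum_(i <- box d N) phi i <= Phi.

Let w i : R := phi i / nu i ^+ 2.
(** The constant term of [cubic_drift] with the sum of weights replaced by its bound [Phi], hence
    independent of the box. *)
Let K : R := (M + 9 * (M + 1) ^+ 2 / (4 * delta)) * (Phi / delta ^+ 2).
Let energy N (x : state d) : R := \sum_(i <- box d N) w i * (x i)%:R ^+ 3.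
Let dissipation N (x : state d) : R :=
  delta / 2 * \sum_(i <- box d N) w i * (x i)%:R ^+ 2.

Let w0 i : 0 < w i.
Proof.
rewrite divr_gt0// exprn_gt0//.
by have := lambda0 i; have := lambda_nu i; have := delta0; lra.
Qed.

Let energy_ge0 N x : 0 <= energy N x.
Proof. by apply: sumr_ge0 => i _; rewrite mulr_ge0 ?exprn_ge0// ltW. Qed.

Let dissipation_ge0 N x : 0 <= dissipation N x.
Proof.
rewrite mulr_ge0 ?divr_ge0 ?(ltW delta0)//.
by apply: sumr_ge0 => i _; rewrite mulr_ge0 ?exprn_ge0// ltW.
Qed.

Let measurable_energy N (dt : measure_display) (T : measurableType dt)
    (x : T -> state d) : (forall i, measurable_fun setT (fun t => x t i)) ->
  measurable_fun setT (fun t => (energy N (x t))%:E).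
Proof.
move=> mx; apply/measurable_EFinP; apply: measurable_sum => i.
apply: measurable_funM; first exact: measurable_cst.
exact: (measurable_nat_comp (fun k => k%:R ^+ 3 : R)).
Qed.

(** [site_moment] summed with the weights [w]. Each site integral is finite, being bounded by [r i],
    so the sums are compared in the reals, where [cubic_drift] applies. *)
Lemma drift_moment N (x : state d) :
  (forall i, i \notin box d N -> x i = 0%N) ->
  (\int[P]_w (energy N (step alg a x (truncate N (arrivals w 0)) (clocks w 0)))%:E
   + (dissipation N x)%:E <= (energy N x)%:E + K%:E)%E.
Proof.
move=> xB.
pose s w := step alg a x (truncate N (arrivals w 0)) (clocks w 0).
pose I i := (\int[P]_w ((s w i)%:R ^+ 3)%:E)%E.
pose r i : R := (x i)%:R ^+ 3 + 3 * (x i)%:R ^+ 2 * lambda i +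
  3 * (x i)%:R * (M + 1) + M.
pose q i : R := 3 * (x i)%:R ^+ 2 * psi a (fun j => (x j)%:R) i.
have I0 i : (0 <= I i)%E by apply: integral_ge0 => v _; rewrite lee_fin exprn_ge0.
have Iq i : (I i + (q i)%:E <= (r i)%:E)%E.
  exact: (site_moment alg a0 age0 aL hdr U1 xiM).
have Ifin i : I i \is a fin_num.
  rewrite ge0_fin_numE//; apply: le_lt_trans (ltry (r i)).
  apply: le_trans (Iq i); rewrite leeDl// lee_fin; apply: mulr_ge0.
    by rewrite mulr_ge0 ?exprn_ge0.
  by apply: (psi_ge0 age0 aL) => j.
have Ir i : fine (I i) + q i <= r i.
  by rewrite -lee_fin EFinD fineK.
have ms i : measurable_fun setT (fun v => ((s v i)%:R ^+ 3 : R)%:E).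
  apply: (measurable_nat_comp (fun k => (k%:R ^+ 3 : R)%:E)).
  exact: (measurable_step_noise alg a0 age0 aL).
have -> : (\int[P]_w (energy N (s w))%:E)%E =
    (\sum_(i <- box d N) w i * fine (I i))%:E.
  rewrite -sumEFin.
  transitivity (\int[P]_v (\sum_(i <- box d N) (w i)%:E * ((s v i)%:R ^+ 3)%:E))%E.
    by apply: eq_integral => v _; rewrite /energy -sumEFin.
  rewrite ge0_integral_sum//.
  - apply: eq_bigr => i _.
    rewrite ge0_integralZl_EFin//; last exact: ltW.
    by rewrite [RHS]EFinM fineK.
  - by move=> i; apply: emeasurable_funM => //; exact: measurable_cst.
  - by move=> i v _; rewrite -EFinM lee_fin mulr_ge0 ?exprn_ge0// ltW.
rewrite -!EFinD lee_fin.
have xB' i : i \notin box d N -> (x i)%:R = 0 :> R by move=> /xB ->.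
have := @cubic_drift R d a L a0 asym age0 aL (box d N) p nu lambda phi c delta
  (fun i => (x i)%:R) (box_uniq d N) p0 nup delta0 lambda0 lambda_nu phi0 
  (fun i j aij => phic (aL aij)) c_delta (fun i => ler0n _ _) xB' M M0.
rewrite -/w -/(dissipation N x) -/(energy N x) => h.
have h1 : \sum_(i <- box d N) w i * fine (I i) +
    \sum_(i <- box d N) w i * q i <= \sum_(i <- box d N) w i * r i.
  rewrite -big_split/=; apply: ler_sum => i _.
  by rewrite -mulrDr ler_pM2l.
have h2 : (M + 9 * (M + 1) ^+ 2 / (4 * delta)) *
    (\sum_(i <- box d N) phi i / delta ^+ 2) <= K.
  rewrite /K ler_wpM2l//.
    by rewrite addr_ge0// divr_ge0 ?mulr_ge0 ?exprn_ge0 ?addr_ge0// ltW.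
  by rewrite -mulr_suml ler_pM2r// invr_gt0 exprn_gt0.
move: h h1 h2; rewrite -/(q _) -/(r _).
rewrite /dissipation /energy /q /r /w; lra.
Qed.

Lemma dissipation_le N k :
  (\int[P]_v (dissipation N (past_queue N k v))%:E <= K%:E)%E.
Proof.
have mY := measurable_past_queue alg a0 age0 aL xi U N k.
have mY' := measurable_past_queue alg a0 age0 aL xi U N k.+1.
have mE (G : state d -> R) : G = energy N -> measurable_fun setT (fun x => (G x)%:E).
  move=> ->; apply: measurable_energy => i.
  exact: (@measurable_coordinate 'rV[int]_d _ nat).
have mD : measurable_fun setT (fun v => (dissipation N (past_queue N k v))%:E).
  apply/measurable_EFinP; apply: measurable_funM; first exact: measurable_cst.
  apply: measurable_sum => i; apply: measurable_funM; first exact: measurable_cst.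
  exact: (measurable_nat_comp (fun k => k%:R ^+ 2 : R)).
pose E k := (\int[P]_v (energy N (past_queue N k v))%:E)%E.
have Efin : E k \is a fin_num.
  rewrite ge0_fin_numE; last by apply: integral_ge0 => v _; rewrite lee_fin.
  (* With truncated arrivals a queue holds at most [k * N] jobs after [k] slots. *)
  pose C : R := \sum_(i <- box d N) w i * (k * N)%:R ^+ 3.
  apply: (@le_lt_trans _ _ C%:E); last exact: ltry.
  have -> : C%:E = (\int[P]_v C%:E)%E.
    rewrite integral_cst//; rewrite [X in (_ * X)%E]probability_setT; exact/esym/mule1.
  apply: ge0_le_integral => //.
  - by move=> v _; rewrite lee_fin.
  - exact: measurable_energy.
  - move=> v _; rewrite lee_fin; apply: ler_sum => i _; rewrite ler_pM2l//.
    by rewrite lerXn2r ?nnegrE// ler_nat back_bound.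
have Emono : (E k <= E k.+1)%E.
  apply: ge0_le_integral => //.
  - by move=> v _; rewrite lee_fin.
  - exact: measurable_energy.
  - exact: measurable_energy.
  - move=> v _; rewrite lee_fin; apply: ler_sum => i _; rewrite ler_pM2l//.
    rewrite lerXn2r ?nnegrE// ler_nat.
    by apply: (back_mono alg a0 age0 aL) => // t j; exact: U1.
have mnext : measurable_fun setT (fun z : Omega * Omega =>
    (energy N (step alg a (past_queue N k z.1) (truncate N (arrivals z.2 0))
      (clocks z.2 0)))%:E).
  apply: measurable_energy => i.
  exact: (measurable_next_queue alg a0 age0 aL).
pose F v := (\int[P]_v' (energy N (step alg a (past_queue N k v)
  (truncate N (arrivals v' 0)) (clocks v' 0)))%:E)%E.
have F0 v : (0 <= F v)%E by apply: integral_ge0 => v' _; rewrite lee_fin.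
have mF : measurable_fun setT F.
  by apply: (measurable_fun_fubini_tonelli_F _ mnext) => z; rewrite lee_fin.
have EF : E k.+1 = (\int[P]_v F v)%E.
  apply: (past_queue_step_law alg a0 age0 aL hdr N k (mE _ erefl)) => x.
  by rewrite lee_fin.
have K0 : 0 <= K.
  rewrite /K mulr_ge0//.
    by rewrite addr_ge0// divr_ge0 ?mulr_ge0 ?exprn_ge0 ?addr_ge0// ltW.
  rewrite divr_ge0 ?exprn_ge0 ?(ltW delta0)//.
  apply: le_trans (phiPhi 0); apply: sumr_ge0 => i _; exact: ltW.
have : (E k.+1 + \int[P]_v (dissipation N (past_queue N k v))%:E <= E k + K%:E)%E.
  rewrite EF -ge0_integralD//; last by move=> v _; rewrite lee_fin.
  have -> : (E k + K%:E = \int[P]_v ((energy N (past_queue N k v))%:E + K%:E))%E.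
    rewrite ge0_integralD//.
    - rewrite integral_cst//; rewrite [X in (_ * X)%E]probability_setT.
      by rewrite mule1.
    - by move=> v _; rewrite lee_fin.
    - exact: measurable_energy.
  apply: ge0_le_integral => //.
  - by move=> v _; rewrite adde_ge0// lee_fin.
  - exact: emeasurable_funD.
  - by apply: emeasurable_funD; [exact: measurable_energy|exact: measurable_cst].
  - move=> v _; apply: drift_moment => i; rewrite mem_box -ltnNge.
    exact: back_support.
move=> h; have := le_trans (leeD Emono (lexx _)) h.
by rewrite leeD2lE.
Qed.

Lemma weighted_second_moment N k i :
  (\int[P]_v ((past_queue N k v i)%:R ^+ 2)%:E <= (2 * K / (delta * w i))%:E)%E.
Proof.
have mY := measurable_past_queue alg a0 age0 aL xi U N k.
have wd : 0 < delta / 2 * w i by rewrite mulr_gt0// divr_gt0.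
have -> : 2 * K / (delta * w i) = (delta / 2 * w i)^-1 * K.
  by field; rewrite !gt_eqF.
rewrite EFinM lee_pdivlMl//; apply: le_trans (dissipation_le N k).
have m2 j : measurable_fun setT (fun v => ((past_queue N k v j)%:R ^+ 2 : R)).
  exact: (measurable_nat_comp (fun k => k%:R ^+ 2 : R)).
rewrite -ge0_integralZl_EFin//; [|exact/measurable_EFinP|exact: ltW].
apply: ge0_le_integral => //.
- by move=> v _; rewrite -EFinM lee_fin mulr_ge0 ?exprn_ge0// ltW.
- by apply: emeasurable_funM; [exact: measurable_cst|exact/measurable_EFinP].
- apply/measurable_EFinP; apply: measurable_funM; first exact: measurable_cst.
  by apply: measurable_sum => j; apply: measurable_funM => //; exact: measurable_cst.
move=> v _; rewrite -EFinM lee_fin /dissipation -[leLHS]mulrA; apply: ler_wpM2l.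
  by rewrite divr_ge0// ltW.
have [iB|iB] := boolP (i \in box d N); last first.
  rewrite (_ : past_queue N k v i = 0%N).
    rewrite expr0n/= mulr0; apply: sumr_ge0 => j _.
    by rewrite mulr_ge0 ?exprn_ge0// ltW.
  by move: iB; rewrite mem_box -ltnNge; exact: back_support.
rewrite (big_rem i)//= lerDl; apply: sumr_ge0 => j _.
by rewrite mulr_ge0 ?exprn_ge0// ltW.
Qed.

End Weighted.

Lemma second_moment_bounded i : exists C : R, forall N k,
  (\int[P]_v ((past_queue N k v i)%:R ^+ 2)%:E <= C%:E)%E.
Proof.
have [phi [c [Phi [h1 h2 h3 h4]]]] := geometric_weights d L delta0.
exists (2 * ((M + 9 * (M + 1) ^+ 2 / (4 * delta)) * (Phi / delta ^+ 2)) /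
  (delta * (phi i / nu i ^+ 2))) => N k.
exact: (weighted_second_moment h1 h2 h3 h4).
Qed.

End SecondMoment.

(** * Stationarity *)

Section AlmostEverywhere.
Context (R : realType) (dt : measure_display) (T : measurableType dt).

Lemma ae_forall_countable (mu : {measure set T -> \bar R}) (I : countType)
    (Q : I -> T -> Prop) :
  (forall i, {ae mu, forall t, Q i t}) -> {ae mu, forall t, forall i, Q i t}.
Proof.
move=> aeQ.
have : {ae mu, forall t, forall n, if choice.unpickle n is Some i then Q i t else True}.
  apply: ae_foralln => n; case: (choice.unpickle n) => [i|]; first exact: aeQ.
  exact: aeW.
apply: filterS => t Qt i; by have := Qt (choice.pickle i); rewrite choice.pickleK.
Qed.

Lemma ae_measure_le (mu : {measure set T -> \bar R}) (A B : set T) :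
  measurable A -> measurable B -> {ae mu, forall t, A t -> B t} ->
  (mu A <= mu B)%E.
Proof.
move=> mA mB [N [mN N0 NP]].
apply: (@le_trans _ _ (mu (B `|` N))).
  apply: le_measure; rewrite ?inE//; first exact: measurableU.
  move=> t At; have [Bt|Bt] := pselect (B t); first by left.
  by right; apply: NP => /(_ At).
apply: (le_trans (measureU2 _ mB mN)).
by rewrite [X in (_ + X)%E]N0 adde0.
Qed.

Lemma ae_measure_eq (mu : {measure set T -> \bar R}) (A B : set T) :
  measurable A -> measurable B -> {ae mu, forall t, A t <-> B t} -> mu A = mu B.
Proof.
move=> mA mB AB; apply/eqP; rewrite eq_le; apply/andP; split.
  by apply: ae_measure_le => //; apply: filterS AB => t [].
by apply: ae_measure_le => //; apply: filterS AB => t [].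
Qed.

Lemma ae_fst (dt' : measure_display) (T' : measurableType dt')
    (P : probability T R) (P' : probability T' R) (Q : T -> Prop) :
  {ae P, forall t, Q t} -> {ae (P \x P')%E, forall z, Q z.1}.
Proof.
move=> [N [mN N0 NQ]]; exists [set z | N z.1]; split.
- by rewrite -[X in measurable X]setTI; exact: measurable_fst.
- exact: etrans (product_fst P P' mN) N0.
- by move=> z /= nQ; apply: NQ.
Qed.

Lemma ae_snd (dt' : measure_display) (T' : measurableType dt')
    (P' : probability T' R) (P : probability T R) (Q : T -> Prop) :
  {ae P, forall t, Q t} -> {ae (P' \x P)%E, forall z, Q z.2}.
Proof.
move=> [N [mN N0 NQ]]; exists [set z | N z.2]; split.
- by rewrite -[X in measurable X]setTI; exact: measurable_snd.
- exact: etrans (product_snd P' P mN) N0.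
- by move=> z /= nQ; apply: NQ.
Qed.

End AlmostEverywhere.

Section PushforwardProduct.
Context (R : realType) (d1 d2 d3 : measure_display) (T1 : measurableType d1)
  (T2 : measurableType d2) (T3 : measurableType d3)
  (P1 : probability T1 R) (P2 : probability T2 R).

Lemma product_distribution (X : {mfun T1 >-> T3}) (A : set (T3 * T2)) :
  measurable A ->
  (distribution P1 X \x P2)%E A = (P1 \x P2)%E [set z | A (X z.1, z.2)].
Proof.
move=> mA.
have mf : measurable_fun setT (fun x => P2 (xsection A x)).
  exact: measurable_fun_xsection.
transitivity (\int[distribution P1 X]_x P2 (xsection A x))%E; first by [].
have := @ge0_integral_pushforward _ _ _ _ _ X (measurable_funPT X) P1 setT
  (fun x => P2 (xsection A x)) measurableT mf (fun x _ => measure_ge0 P2 _).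
rewrite preimage_setT => ->.
by apply: eq_integral => x _ /=; congr (P2 _).
Qed.

End PushforwardProduct.

Section QueueEvents.
Context (R : realType) (d : nat) (alg : algorithm) (a : 'rV[int]_d -> R).
Context (L : nat).
Hypothesis a0 : a 0 = 1.
Hypothesis age0 : forall i, 0 <= a i.
Hypothesis aL : forall i, 0 < a i -> (supnorm i <= L)%N.
Context (dd : measure_display) (Omega : measurableType dd)
  (P : probability Omega R).
Context (xi : nat -> 'rV[int]_d -> {RV P >-> nat})
  (U : nat -> 'rV[int]_d -> {RV P >-> R}).

Lemma measurable_queues_event k n (A : nat -> set (state d)) :
  (forall m, measurable (A m)) ->
  measurable [set z | forall m, (m <= n)%N -> A m (queues alg a xi U (k + m) z)].
Proof.
move=> mA.
rewrite (_ : [set z | _] = \bigcap_(m in [set m | (m <= n)%N])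
    (queues alg a xi U (k + m) @^-1` A m)); last first.
  by apply/seteqP; split => z h m /h.
apply: bigcap_measurable => [|m _]; first by exists 0%N.
rewrite -[X in measurable X]setTI.
have mq : measurable_fun setT (queues alg a xi U (k + m)).
  rewrite (_ : queues _ _ _ _ _ = fun z => trajectory alg a
    (fun t i => xi t i z.2) (fun t i => U t i z.2) (k + m) z.1); last first.
    by apply/funext => z; rewrite queuesE.
  apply: (measurable_trajectory alg a0 age0 aL) => // [s j|s j].
  - exact: (measurableT_comp (measurable_funPT (xi s j)) measurable_snd).
  - exact: (measurableT_comp (measurable_funPT (U s j)) measurable_snd).
exact: mq.
Qed.

End QueueEvents.

Section Stationarity.
Context (R : realType) (d : nat) (alg : algorithm) (a : 'rV[int]_d -> R).
Context (L : nat).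
Hypothesis a0 : a 0 = 1.
Hypothesis age0 : forall i, 0 <= a i.
Hypothesis aL : forall i, 0 < a i -> (supnorm i <= L)%N.
Context (dd : measure_display) (Omega : measurableType dd)
  (P : probability Omega R).
Context (xi : nat -> 'rV[int]_d -> {RV P >-> nat})
  (U : nat -> 'rV[int]_d -> {RV P >-> R}) (lambda : 'rV[int]_d -> R).
Hypothesis hdr : driving xi U lambda.
Hypothesis U1 : forall k i w, U k i w <= 1.

Local Notation arrivals := (arrivals xi).
Local Notation clocks := (clocks U).
Local Notation past_queue := (past_queue alg a xi U).

Definition loynes_queue (w : Omega) : state d :=
  loynes alg a (arrivals w) (clocks w).

Lemma measurable_loynes_queue : measurable_fun setT loynes_queue.
Proof.
apply: (measurable_loynes alg a0 age0 aL) => s j; exact: measurable_funPT.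
Qed.

HB.instance Definition _ :=
  isMeasurableFun.Build _ _ _ _ loynes_queue measurable_loynes_queue.

Definition loynes_law : probability (state d) R := distribution P loynes_queue.

Section Moments.
Hypothesis m2 : forall i, exists C : R, forall N k,
  (\int[P]_w ((past_queue N k w i)%:R ^+ 2)%:E <= C%:E)%E.

Let sq i n w : \bar R := ((past_queue n n w i)%:R ^+ 2)%:E.

Let past_queue_mono i w : {homo (fun n => past_queue n n w i) : p q / (p <= q)%N}.
Proof.
by move=> p q pq; apply: (back_mono alg a0 age0 aL) => // t j; exact: U1.
Qed.

Let sq_mono i w : nondecreasing_seq (sq i ^~ w).
Proof.
move=> p q pq; rewrite lee_fin lerXn2r ?nnegrE// ler_nat.
exact: past_queue_mono.
Qed.

Let measurable_sq i n : measurable_fun setT (sq i n).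
Proof.
apply: (measurable_nat_comp (fun k => (k%:R ^+ 2 : R)%:E)).
exact: (measurable_past_queue alg a0 age0 aL).
Qed.

Let sq_le_lim i n w : (sq i n w <= limn (sq i ^~ w))%E.
Proof.
have /cvg_lim -> // := ereal_nondecreasing_cvgn (sq_mono i w).
by apply: ereal_sup_ubound; exists n.
Qed.

Let integral_lim_sq i : exists C : R,
  (\int[P]_w limn (sq i ^~ w) <= C%:E)%E.
Proof.
have [C hC] := m2 i; exists C.
rewrite monotone_convergence//.
- apply: lime_le; last by apply: nearW => n; exact: hC.
  apply: ereal_nondecreasing_is_cvgn => p q pq.
  apply: ge0_le_integral => //.
  + by move=> w _; rewrite lee_fin exprn_ge0.
  + by move=> w _; exact: sq_mono.
- by move=> n w _; rewrite lee_fin exprn_ge0.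
Qed.

Let measurable_lim_sq i : measurable_fun setT (fun w => limn (sq i ^~ w)).
Proof.
apply: (emeasurable_fun_cvg (sq i)) => // w _.
exact: (ereal_nondecreasing_is_cvgn (sq_mono i w)).
Qed.

Lemma ae_loynes_bounded :
  {ae P, forall w, loynes_bounded alg a (arrivals w) (clocks w)}.
Proof.
apply: ae_forall_countable => i.
have [C hC] := integral_lim_sq i.
have lim0 w : (0 <= limn (sq i ^~ w))%E.
  by apply: le_trans (sq_le_lim i 0 w); rewrite lee_fin exprn_ge0.
have intl : P.-integrable setT (fun w => limn (sq i ^~ w)).
  apply/integrableP; split => //.
  under eq_integral do rewrite gee0_abs//.
  exact: le_lt_trans hC (ltry _).
apply: filterS (integrable_ae measurableT intl) => w /(_ I) fin.
exists (Num.truncn (fine (limn (sq i ^~ w)))) => n.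
rewrite truncn_ge_nat; last exact: fine_ge0.
rewrite -lee_fin fineK//; apply: le_trans (sq_le_lim i n w).
have le_sqr (q : nat) : (q <= q ^ 2)%N by case: q => // q; rewrite leq_pmulr.
by rewrite lee_fin -natrX ler_nat; exact: le_sqr.
Qed.

Lemma loynes_law_second_moment i :
  ('E_loynes_law[fun x : state d => ((x i)%:R ^+ 2)%R] < +oo)%E.
Proof.
rewrite unlock.
have mg : measurable_fun setT (fun x : state d => ((x i)%:R ^+ 2 : R)%:E).
  apply: (measurable_nat_comp (fun k => (k%:R ^+ 2 : R)%:E)).
  exact: (@measurable_coordinate 'rV[int]_d _ nat).
rewrite (@ge0_integral_distribution _ _ _ _ _ P loynes_queue _ mg); last first.
  by move=> x; rewrite lee_fin exprn_ge0.
have [C hC] := integral_lim_sq i; apply: le_lt_trans (ltry C).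
apply: le_trans hC; apply: ge0_le_integral => //.
- by move=> w _; rewrite lee_fin exprn_ge0.
- exact: (measurableT_comp mg measurable_loynes_queue).
- move=> w _ /=; rewrite /loynes_queue /loynes /eventual_value.
  case: xgetP => [y -> [_ [n <-]]|_].
    exact: sq_le_lim.
  exact: (sq_le_lim i 0 w).
Qed.

End Moments.

Hypothesis bounded : {ae P, forall w, loynes_bounded alg a (arrivals w) (clocks w)}.

Let start (Z : noise_config R d) : state d :=
  loynes alg a (arrivals_of false Z) (clocks_of false Z).
Let path k (Z : noise_config R d) : state d :=
  trajectory alg a (arrivals_of true Z) (clocks_of true Z) k (start Z).

Let measurable_path k : measurable_fun setT (path k).
Proof.
apply: (measurable_trajectory alg a0 age0 aL).
- move=> s i; exact: measurable_arrivals_of.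
- move=> s i; exact: measurable_clocks_of.
apply: (measurable_loynes alg a0 age0 aL) => s j.
  exact: measurable_arrivals_of.
exact: measurable_clocks_of.
Qed.

Let path_shift k (Z : noise_config R d) : (forall b t i, clocks_of b Z t i <= 1) ->
  loynes_bounded alg a (arrivals_of false Z) (clocks_of false Z) ->
  path k (fun c => Z (shift c)) = path k.+1 Z.
Proof.
move=> Z1 Zb; rewrite /path /start arrivals_of_shift_past clocks_of_shift_past.
rewrite (loynes_scons a0 age0 aL)//.
transitivity (trajectory alg a
    (scons (arrivals_of true Z 0) (arrivals_of true (fun c => Z (shift c))))
    (scons (clocks_of true Z 0) (clocks_of true (fun c => Z (shift c))))
    k.+1 (start Z)); first by rewrite trajectory_scons.
rewrite /path; congr trajectory.
- by apply/funext => -[|t]//; apply/funext.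
- by apply/funext => -[|t]//; apply/funext.
Qed.

Let event k n (A : nat -> set (state d)) : set (noise_config R d) :=
  [set Z | forall m, (m <= n)%N -> A m (path (k + m) Z)].

Let measurable_event k n A : (forall m, measurable (A m)) ->
  measurable (event k n A).
Proof.
move=> mA; rewrite (_ : event k n A =
  \bigcap_(m in [set m | (m <= n)%N]) (path (k + m) @^-1` A m)).
  apply: bigcap_measurable => [|m _]; first by exists 0%N.
  rewrite -[X in measurable X]setTI.
  exact: measurable_path.
by apply/seteqP; split => Z h m /h.
Qed.

Lemma loynes_stationary : stationary_regime alg a xi U loynes_law.
Proof.
move=> k n A mA.
pose S k : set (state d * Omega) :=
  [set z | forall m, (m <= n)%N -> A m (queues alg a xi U (k + m) z)].
have mS l : measurable (S l).
  exact: (measurable_queues_event alg a0 age0 aL xi U l n mA).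
have SE l : (loynes_law \x P)%E (S l) =
    (P \x P)%E [set z | event l n A (two_copies (noise xi U) z)].
  rewrite (product_distribution P P loynes_queue (mS l)).
  congr (_ _); apply/seteqP; split => z h m mn; have := h m mn;
    by rewrite queuesE.
have step l : (P \x P)%E [set z | event l.+1 n A (two_copies (noise xi U) z)] =
    (P \x P)%E [set z | event l n A (two_copies (noise xi U) z)].
  rewrite -(shift_measure hdr (measurable_event l n mA)).
  have mtc : measurable_fun setT (fun z => two_copies (noise xi U) z : noise_config R d).
    exact: (measurable_reindexed_copies (measurable_noise xi U) id).
  apply: ae_measure_eq.
  - rewrite -[X in measurable X]setTI; apply: mtc => //.
    exact: measurable_event.
  - rewrite -[X in measurable X]setTI.
    apply: (measurable_reindexed_copies (measurable_noise xi U) (@shift d)) => //.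
    exact: measurable_event.
  - apply: filterS (ae_fst P bounded) => z zb.
    have E m : path (l + m) (fun c => two_copies (noise xi U) z (shift c)) =
        path (l.+1 + m) (two_copies (noise xi U) z).
      rewrite path_shift//; first by move=> [] t i; exact: U1.
    by split => h m mn; have := h m mn; rewrite E.
rewrite -/(S k) (_ : [set z | _] = S 0%N)//.
rewrite !SE; elim: k => // k IHk; by rewrite step.
Qed.

End Stationarity.

(** * Reduction to bounded clocks and uniform constants *)

Section Periodicity.
Context (R : realType) (d : nat) (C : 'I_d -> nat).
Hypothesis hC : forall k, (0 < C k)%N.

Lemma lattice_periodic_mod (T : Type) (f : 'rV[int]_d -> T) i :
  lattice_periodic C f -> f i = f (\row_k (i 0%R k %% (C k)%:Z)%Z).
Proof.
move=> fC.
have fn k (n : nat) j : f (j + (delta_mx 0 k *+ C k) *+ n) = f j.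
  elim: n => [|n IHn]; first by rewrite mulr0n addr0.
  by rewrite mulrSr addrA fC.
have fz k (z : int) j : f (j + (delta_mx 0 k *+ C k) *~ z) = f j.
  case: z => n; first exact: fn.
  by rewrite NegzE mulrNz -[in RHS](subrK ((delta_mx 0 k *+ C k) *+ n.+1) j) fn.
have fs (s : seq 'I_d) (z : 'I_d -> int) j :
    f (j + \sum_(k <- s) (delta_mx 0 k *+ C k) *~ z k) = f j.
  elim: s j => [|k s IHs] j; first by rewrite big_nil addr0.
  by rewrite big_cons addrA IHs fz.
have entry l k (n : nat) (z : int) :
    ((delta_mx 0 l *+ n) *~ z : 'rV[int]_d) 0 k = z * n%:Z * (k == l)%:Z.
  have pos (m : nat) : ((delta_mx 0 l *+ n) *+ m : 'rV[int]_d) 0 k =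
      m%:Z * n%:Z * (k == l)%:Z.
    rewrite !mulmxnE mxE eqxx/=; case: (k == l); last by rewrite !mul0rn mulr0.
    by rewrite -mulrnA mulnC mulr1 -natz natrM !natz.
  case: z => m; first exact: pos.
  by rewrite NegzE mulrNz mxE pos -!mulrA mulNr.
rewrite -(fs (index_enum _) (fun k => - (i 0%R k %/ (C k)%:Z)%Z) i); congr f.
apply/rowP => k; rewrite !mxE summxE (bigD1 k)//= big1 ?addr0; last first.
  by move=> l lk; rewrite entry eq_sym (negbTE lk) mulr0.
rewrite entry eqxx mulr1 mulNr; have := divz_eq (i 0 k) (C k); lia.
Qed.

Lemma periodic_bounded (g : 'rV[int]_d -> R) : lattice_periodic C g ->
  exists M, 0 <= M /\ forall i, g i <= M.
Proof.
move=> gC; pose N := (\max_k C k)%N.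
exists (\sum_(j <- box d N) `|g j|); split=> [|i]; first by apply: sumr_ge0.
rewrite (lattice_periodic_mod i gC); set j := \row_k _.
have jB : j \in box d N.
  rewrite mem_box; apply/supnorm_le => k; rewrite mxE.
  have h0 : (0 <= (i 0%R k %% (C k)%:Z)%Z)%R by rewrite modz_ge0// eqz_nat -lt0n.
  have h1 : ((i 0%R k %% (C k)%:Z)%Z < (C k)%:Z)%R by rewrite ltz_pmod// ltz_nat.
  apply: leq_trans (leq_bigmax k); lia.
rewrite (big_rem j)//= (le_trans (ler_norm _))// lerDl; exact: sumr_ge0.
Qed.

End Periodicity.

Section Clipping.
Context (R : realType) (d : nat) (dd : measure_display)
  (Omega : measurableType dd) (P : probability Omega R).
Context (xi : nat -> 'rV[int]_d -> {RV P >-> nat})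
  (U : nat -> 'rV[int]_d -> {RV P >-> R}) (lambda : 'rV[int]_d -> R).
Hypothesis hdr : driving xi U lambda.

(* Under [D1], [step] is monotone in the queues only for clocks that are at most
   1, which the law of [U] guarantees only almost surely. *)
Definition clip k i (w : Omega) : R := Num.min (U k i w) 1.

Lemma measurable_clip k i : measurable_fun setT (clip k i).
Proof.
by apply: measurable_minr; [exact: measurable_funPT|exact: measurable_cst].
Qed.

HB.instance Definition _ k i :=
  isMeasurableFun.Build _ _ _ _ (clip k i) (measurable_clip k i).

Lemma clip_le1 k i w : clip k i w <= 1.
Proof. by rewrite /clip ge_min lexx orbT. Qed.

Lemma ae_clock_le1 k i : {ae P, forall w, U k i w <= 1}.
Proof.
case: hdr => _ _ _ hU.
exists [set w | 1 < U k i w]; split.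
- rewrite -[X in measurable X]setTI.
  have mb : measurable_fun setT (fun w => 1 < U k i w).
    by apply: measurable_fun_ltr; [exact: measurable_cst|exact: measurable_funPT].
  exact: (mb measurableT [set true]).
- have mI : measurable (`]1%R, +oo[%classic : set R) by exact: measurable_itv.
  have : distribution P (U k i) `]1%R, +oo[%classic = 0%E.
    rewrite hU// /uniform_prob integral_uniform_pdf.
    rewrite (_ : _ `&` _ = set0) ?integral_set0//.
    apply/seteqP; split => // u []; rewrite /= !in_itv/= andbT => u1.
    by move=> /andP[_]; rewrite leNgt u1.
  move=> <-; congr (P _); apply/seteqP; split => w /=; rewrite in_itv/= andbT//.
- by move=> w /= /negP; rewrite -ltNge.
Qed.

Lemma clip_driving : driving xi (fun k i => clip k i : {RV P >-> R}) lambda.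
Proof.
case: hdr => hind h2 h3 hU; split => //.
- move=> J E hE; apply: hind => -[[k i]|[k i]] jJ; have := hE _ jJ => //=.
  move=> [B mB <-]; exists ((fun u : R => Num.min u 1) @^-1` B); last by [].
  rewrite -[X in measurable X]setTI.
  have mm : measurable_fun setT (fun u : R => Num.min u 1).
    by apply: measurable_minr; [exact: measurable_id|exact: measurable_cst].
  exact: (mm measurableT B mB).
- move=> k i A mA; rewrite -(hU k i A mA).
  apply: (@ae_measure_eq _ _ _ P (clip k i @^-1` A) (U k i @^-1` A)).
  + by rewrite -[X in measurable X]setTI; exact: (measurable_clip k i measurableT mA).
  + by rewrite -[X in measurable X]setTI; exact: (@measurable_funPT _ _ _ _ (U k i) measurableT A mA).
  + apply: filterS (ae_clock_le1 k i) => w Uw.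
    by rewrite /preimage/= /clip min_l.
Qed.

End Clipping.

Lemma stationary_regime_ae (R : realType) (d : nat) (alg : algorithm)
    (a : 'rV[int]_d -> R) (L : nat) (a0 : a 0 = 1) (age0 : forall i, 0 <= a i)
    (aL : forall i, 0 < a i -> (supnorm i <= L)%N)
    (dd : measure_display) (Omega : measurableType dd)
    (P : probability Omega R)
    (xi : nat -> 'rV[int]_d -> {RV P >-> nat})
    (U V : nat -> 'rV[int]_d -> {RV P >-> R}) (pi : probability (state d) R) :
  (forall k i, {ae P, forall w, V k i w = U k i w}) ->
  stationary_regime alg a xi V pi -> stationary_regime alg a xi U pi.
Proof.
move=> VU statV k n A mA.
have aeVU : {ae P, forall w, forall k i, V k i w = U k i w}.
  by apply: ae_forall_countable => s; apply: ae_forall_countable => i.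
have E l : (pi \x P)%E [set z | forall m, (m <= n)%N ->
      A m (queues alg a xi U (l + m) z)] =
    (pi \x P)%E [set z | forall m, (m <= n)%N ->
      A m (queues alg a xi V (l + m) z)].
  apply: ae_measure_eq; [exact: (measurable_queues_event _ a0 age0 aL)..|].
  apply: filterS (ae_snd pi aeVU) => z zVU.
  have Q m : queues alg a xi U m z = queues alg a xi V m z.
    elim: m => //= m ->; congr step; apply/funext => i; by rewrite zVU.
  by split => h m /h; rewrite Q.
by rewrite (E k) (E 0%N) statV.
Qed.

Lemma stationary_regime_distribution (R : realType) (d : nat) (alg : algorithm)
    (a : 'rV[int]_d -> R) (dd : measure_display) (Omega : measurableType dd)
    (P : probability Omega R)
    (xi : nat -> 'rV[int]_d -> {RV P >-> nat})
    (U : nat -> 'rV[int]_d -> {RV P >-> R}) (pi : probability (state d) R) :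
  stationary_regime alg a xi U pi -> stationary_distribution alg a xi U pi.
Proof.
move=> stat k A mA; have := stat k 0%N (fun=> A) (fun=> mA).
have E l : [set z : state d * Omega | forall m, (m <= 0)%N ->
    A (queues alg a xi U (l + m) z)] = [set z | A (queues alg a xi U l z)].
  apply/seteqP; split => z /= h; first by have := h 0%N (leqnn _); rewrite addn0.
  by move=> m; rewrite leqn0 => /eqP ->; rewrite addn0.
by rewrite (E k) (E 0%N) => ->; exact: product_fst.
Qed.

Theorem theorem6 (R : realType) (d : nat) (alg : algorithm)
  (a : 'rV[int]_d -> R) (ha : interaction a)
  (C : 'I_d -> nat) (hC : forall k, (0 < C k)%N)
  (dd : measure_display) (Omega : measurableType dd) (P : probability Omega R)
  (xi xi' : nat -> 'rV[int]_d -> {RV P >-> nat})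
  (U : nat -> 'rV[int]_d -> {RV P >-> R})
  (lambda lambda' nu : 'rV[int]_d -> R)
  (hxi : driving xi U lambda)
  (hlambda : lattice_periodic C lambda)
  (hxi_periodic : forall k, lattice_periodic C (fun i => distribution P (xi k i)))
  (hxi_moment : forall k i, ('E_P[fun w => ((xi k i w)%:R ^+ 3)%R] < +oo)%E)
  (hnu : rate_region a nu) (hnu_periodic : lattice_periodic C nu)
  (hlambda_nu : forall i, lambda i < nu i)
  (hxi' : driving xi' U lambda')
  (hlambda' : forall i, lambda' i <= lambda i)
  (hdom : forall k i, {ae P, forall w, (xi' k i w <= xi k i w)%N}) :
  stable alg a xi' U /\
  exists pi : probability (state d) R,
    stationary_regime alg a xi' U pi /\
    forall i, ('E_pi[fun x : state d => ((x i)%:R ^+ 2)%R] < +oo)%E.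
Proof.
have [a0 asym age0 [L aL]] := ha.
have [p [p0 nup]] := hnu.
pose V k i : {RV P >-> R} := clip U k i.
have hV : driving xi' V lambda' by exact: clip_driving hxi'.
have V1 k i w : V k i w <= 1 by exact: clip_le1.
have lambda'0 i : 0 <= lambda' i.
  rewrite -lee_fin; case: hxi' => _ _ /(_ 0%N i) <- _; rewrite unlock.
  by apply: integral_ge0 => w _; rewrite lee_fin.
have [delta [delta0 lambda_delta]] : exists delta : R,
    0 < delta /\ forall i, lambda' i + delta <= nu i.
  have gC : lattice_periodic C (fun i => (nu i - lambda i)^-1).
    by move=> i k; rewrite hnu_periodic hlambda.
  have [G [G0 hG]] := periodic_bounded hC gC.
  have G1 : 0 < G + 1 by rewrite ltr_wpDl.
  exists (G + 1)^-1; split=> [|i]; first by rewrite invr_gt0.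
  have gap : 0 < nu i - lambda i by rewrite subr_gt0.
  have : (G + 1)^-1 <= nu i - lambda i.
    rewrite -[leRHS]invrK lef_pV2 ?posrE ?invr_gt0//.
    by rewrite (le_trans (hG i))// lerDl.
  have := hlambda' i; lra.
pose cube (k : nat) : \bar R := (k%:R ^+ 3)%:E.
have mcube (f : nat -> 'rV[int]_d -> {RV P >-> nat}) i :
    measurable_fun setT (fun w => cube (f 0%N i w)).
  exact: (measurable_nat_comp cube (measurable_funPT (f 0%N i))).
have [M [M0 xiM]] : exists M : R, 0 <= M /\
    forall i, (\int[P]_w ((xi' 0%N i w)%:R ^+ 3)%:E <= M%:E)%E.
  pose g i := (\int[P]_w cube (xi 0%N i w))%E.
  have gE i : g i = (\int[distribution P (xi 0%N i)]_n cube n)%E.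
    rewrite (@ge0_integral_distribution _ _ _ _ _ P (xi 0%N i) cube)//.
    by move=> n; rewrite lee_fin exprn_ge0.
  have gC : lattice_periodic C (fun i => fine (g i)).
    move=> i k; congr fine; rewrite !gE; apply: eq_measure_integral => A mA _.
    exact: (congr1 (fun m : set nat -> \bar R => m A) (hxi_periodic 0%N i k)).
  have [M [M0 hM]] := periodic_bounded hC gC.
  exists M; split=> // i.
  have g_fin : g i \is a fin_num.
    rewrite ge0_fin_numE; first by have := hxi_moment 0%N i; rewrite unlock.
    by apply: integral_ge0 => w _; rewrite lee_fin exprn_ge0.
  apply: (@le_trans _ _ (g i)); last by rewrite -(fineK g_fin) lee_fin.
  have cube0 n : (0 <= cube n)%E by rewrite lee_fin exprn_ge0.
  apply: ae_ge0_le_integral; [exact: measurableT|by move=> w _; exact: cube0|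
    exact: (@mcube xi' i)|by move=> w _; exact: cube0|exact: (@mcube xi i)|].
  apply: filterS (hdom 0%N i) => w le_w _.
  by rewrite lee_fin lerXn2r ?nnegrE// ler_nat.
have m2 := second_moment_bounded alg a0 asym age0 aL hV V1 M0 xiM p0 nup delta0
  lambda'0 lambda_delta.
have bnd := ae_loynes_bounded a0 age0 aL V1 m2.
have statV := loynes_stationary a0 age0 aL hV V1 bnd.
have stat : stationary_regime alg a xi' U (loynes_law alg a0 age0 aL xi' V).
  apply: (stationary_regime_ae a0 age0 aL _ statV) => k i.
  apply: filterS (ae_clock_le1 hxi' k i) => w Uw.
  by rewrite /V/= /clip min_l.
split; first by exists (loynes_law alg a0 age0 aL xi' V);
  exact: stationary_regime_distribution.
exists (loynes_law alg a0 age0 aL xi' V); split; first exact: stat.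
exact: loynes_law_second_moment.
Qed.
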